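(* In the case of Ordinary Kriging, with a Matérn kernel with smoothness $\nu=1$, if $n>r+3$, then: - the reference prior $\pi(\theta)$ is $O(\theta^{-1}\log(\theta)^{-1})$ when $\theta\to+\infty$; - the matrix $\boldsymbol W^\top\boldsymbol D^{(1)}\boldsymbol W$ is singular; - for every vector $\boldsymbol y\in\mathbb R^n$ such that $\boldsymbol W^\top\boldsymbol y$ does not belong to the vector subspace of $\mathbb R^{n-1}$ spanned by the columns of $\boldsymbol W^\top\boldsymbol D^{(1)}\boldsymbol W$, the reference posterior distribution $\pi(\theta\mid\boldsymbol y)\propto L_{\boldsymbol y}(\theta)\pi(\theta)$ is $O(\theta^{-1}\log(\theta)^{-3/2})$ when $\theta\to+\infty$.
   Context: Let $r\ge1$ and let $\boldsymbol x^{(1)},\dots,\boldsymbol x^{(n)}\in\mathbb R^r$ be distinct fixed points. The Matérn kernel with smoothness $\nu>0$ is $K(0)=1$, $K(t)=\Gamma(\nu)^{-1}2^{1-\nu}(2\sqrt\nu\,t)^\nu\mathcal K_\nu(2\sqrt\nu\,t)$ for $t>0$, with $\mathcal K_\nu$ the modified Bessel function of the second kind. For $\theta>0$, $\boldsymbol\Sigma_\theta$ is the $n\times n$ (positive definite) matrix with $(i,i')$-th element $K(\|\boldsymbol x^{(i)}-\boldsymbol x^{(i')}\|/\theta)$. $\boldsymbol D^{(1)}$ is the $n\times n$ matrix with $(i,i')$-th element $\|\boldsymbol x^{(i)}-\boldsymbol x^{(i')}\|^2$. Ordinary Kriging: $p=1$ and $\boldsymbol H=\boldsymbol 1\in\mathbb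 R^n$ is the vector of ones. $\boldsymbol W$ is a fixed $n\times(n-1)$ matrix with $\boldsymbol W^\top\boldsymbol W=\boldsymbol I_{n-1}$ and $\boldsymbol 1^\top\boldsymbol W=\boldsymbol 0$. Put $\boldsymbol\Sigma^{\boldsymbol W}_\theta=\boldsymbol W^\top\boldsymbol\Sigma_\theta\boldsymbol W$. The reference prior on $\theta$ is, up to a positive multiplicative constant (with $p=1$), $$\pi(\theta)=\sqrt{\operatorname{Tr}\Big[\Big\{\big(\tfrac{d}{d\theta}\boldsymbol\Sigma^{\boldsymbol W}_\theta\big)(\boldsymbol\Sigma^{\boldsymbol W}_\theta)^{-1}\Big\}^2\Big]-\frac1{n-p}\Big[\operatorname{Tr}\Big\{\big(\tfrac{d}{d\theta}\boldsymbol\Sigma^{\boldsymbol W}_\theta\big)(\boldsymbol\Sigma^{\boldsymbol W}_\theta)^{-1}\Big\}\Big]^2}.$$ The (integrated) likelihood is $L_{\boldsymbol y}(\theta)=\int_0^\infty\int_{\mathbb R^p}(2\pi\sigma^2)^{-n/2}|\boldsymbol\Sigma_\theta|^{-1/2}\exp\{-\frac1{2\sigma^2}(\boldsymbol y-\boldsymbol H\boldsymbol\beta)^\top\boldsymbol\Sigma_\theta^{-1}(\boldsymbol y-\boldsymbol H\boldsymbol\beta)\}\,d\boldsymbol\beta\,\frac{d\sigma^2}{\sigma^2}$, which equals, up to a positive constant not depending on $\theta$, $|\boldsymbol W^\top\boldsymbol\Sigma_\theta\boldsymbol W|^{-1/2}\big(\boldsymbol y^\top\boldsymbol W(\boldsymbol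 W^\top\boldsymbol\Sigma_\theta\boldsymbol W)^{-1}\boldsymbol W^\top\boldsymbol y\big)^{-(n-p)/2}$. *)

(* Defs.v *)
From HB Require Import structures.
From mathcomp Require Import all_boot all_order all_algebra.
From mathcomp Require Import all_classical all_reals all_analysis.

Set Implicit Arguments.
Unset Strict Implicit.
Unset Printing Implicit Defensive.

Import Order.TTheory GRing.Theory Num.Theory.
Import numFieldNormedType.Exports.

Local Open Scope classical_set_scope.
Local Open Scope ring_scope.

(* Euler's integral, for nu > 0. *)
Definition gammaR (R : realType) (nu : R) : R :=
  Rintegral lebesgue_measure `]0, +oo[ (fun t : R => t `^ (nu - 1) * expR (- t)).

Definition coshR (R : realType) (t : R) : R := (expR t + expR (- t)) / 2.

(* Modified Bessel function of the second kind, for z > 0, through Schlaefli's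
   integral  K_nu(z) = int_0^oo exp(- z cosh t) cosh(nu t) dt. *)
Definition besselK (R : realType) (nu z : R) : R :=
  Rintegral lebesgue_measure `[0, +oo[
    (fun t : R => expR (- z * coshR t) * coshR (nu * t)).

Definition matern (R : realType) (nu t : R) : R :=
  if t == 0 then 1
  else (gammaR nu)^-1 * 2 `^ (1 - nu) * (2 * Num.sqrt nu * t) `^ nu
       * besselK nu (2 * Num.sqrt nu * t).

(* The library norm on matrices is the sup norm, hence this definition. *)
Definition enorm (R : realType) (r : nat) (v : 'cV[R]_r) : R :=
  Num.sqrt (\sum_(j < r) v j 0 ^+ 2).

Section Kriging.
Variables (R : realType) (r n : nat) (x : 'I_n -> 'cV[R]_r).

Definition corr_mx (nu theta : R) : 'M[R]_n :=
  \matrix_(i, j) matern nu (enorm (x i - x j) / theta).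

Definition sqdist_mx : 'M[R]_n := \matrix_(i, j) enorm (x i - x j) ^+ 2.

Definition corrW_mx (W : 'M[R]_(n, n.-1)) (nu theta : R) : 'M[R]_n.-1 :=
  W^T *m corr_mx nu theta *m W.

Definition dcorrW_mx (W : 'M[R]_(n, n.-1)) (nu theta : R) : 'M[R]_n.-1 :=
  \matrix_(i, j) derive1 (fun t : R => corrW_mx W nu t i j) theta.

(* Formula for the reference prior in Ordinary Kriging (p = 1). *)
Definition ref_prior (W : 'M[R]_(n, n.-1)) (nu theta : R) : R :=
  let A := dcorrW_mx W nu theta *m invmx (corrW_mx W nu theta) in
  Num.sqrt (\tr (A *m A) - (n%:R - 1)^-1 * (\tr A) ^+ 2).

(* Integrand of the likelihood; s stands for sigma^2, b for beta, and the factor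
   s^-1 comes from the measure d(sigma^2) / sigma^2. *)
Definition lik_integrand (nu : R) (y : 'cV[R]_n) (theta s b : R) : R :=
  let z : 'cV[R]_n := y - const_mx b in
  (2 * pi * s) `^ (- (n%:R / 2)) * (\det (corr_mx nu theta)) `^ (- (1 / 2))
  * expR (- (2 * s)^-1 * (z^T *m invmx (corr_mx nu theta) *m z) 0 0) * s^-1.

(* Extended-real valued, so that no junk value is used should the integral
   diverge (as it does when y is a multiple of the vector of ones). *)
Definition likelihood (nu : R) (y : 'cV[R]_n) (theta : R) : \bar R :=
  (\int[lebesgue_measure]_(s in `]0%R, +oo[)
     \int[lebesgue_measure]_(b in [set: R])
       (lik_integrand nu y theta s b)%:E)%E.

End Kriging.

(* The library declares no canonical filter_on for this filter, which its
   notation =O_F needs. *)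
Canonical pinfty_filter_on (R : numFieldType) :=
  @FilterType R (pinfty_nbhs R) _.

(* f = c g on the half-line ]0, +oo[ for some constant c > 0. *)
Definition proportional (R : realType) (f g : R -> \bar R) : Prop :=
  exists2 c : R, 0 < c & forall t : R, 0 < t -> f t = (c%:E * g t)%E.

(* f = O(g) at +oo for an extended-real valued f; the library's =O is
   restricted to normed modules. In particular f is finite near +oo. *)
Definition ebigO_pinfty (R : realType) (f : R -> \bar R) (g : R -> R) : Prop :=
  exists k : R, \forall t \near +oo, (`|f t| <= (k * `|g t|)%:E)%E.

(* Main.v *)
Require Import Defs.
From HB Require Import structures.
From mathcomp Require Import all_boot all_order all_algebra.
From mathcomp Require Import all_classical all_reals all_analysis.
From mathcomp Require Import perm measurable_realfun ring lra.

Set Implicit Arguments.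
Unset Strict Implicit.
Unset Printing Implicit Defensive.

Import Order.TTheory GRing.Theory Num.Theory.
Import numFieldNormedType.Exports.

Local Open Scope classical_set_scope.
Local Open Scope ring_scope.

(** At smoothness 1 the Matern correlation is a scale mixture of Gaussian ones.
The substitution s = d t e^{+-u} in Schlaefli's integral gives, with
e = 1 / t^2,
  matern 1 (d / t) = e * mixint (d^2) e,
  mixint q e = int_0^oo exp (- e s - q / s) ds      (matern1E),
so the correlation matrix is e times mixmx x e, the matrix with entries
mixint (|x_i - x_j|^2) e, and everything becomes a question about e -> 0+.
Two properties of mixint answer it.

- Coercivity (mixmx_coercive).  The quadratic form of mixmx x e at a vector a is
  the integral of exp (- e s) H(s), where
  H(s) = sum_ij a_i a_j exp (- |x_i - x_j|^2 / s).  Gaussian kernels being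
  positive semidefinite, H >= 0; and H(s) >= |a|^2 / 2 for s small, because the
  points are distinct and the off-diagonal terms die out.  Hence mixmx x e >= c I
  with the same c > 0 for all e in ]0, 1].
- Expansion (mixint_asymp, mixint1_asymp).  As e -> 0+,
  mixint q e = 1/e + q ln e + O(1), and its derivative follows the derivative of
  1/e + q ln e with an error O(e^{-1/2}).

On contrasts, that is, on vectors orthogonal to the vector of ones, the terms
1/e cancel.  Write N = W^T (mixmx x e) W, D for the matrix of squared distances
and T = - W^T D W, and let N' = t dN/dt.  Then
  N = 2 (ln t) T + O(1),     N' = 2 T + O(1 / t),     T = 2 (X W)^T (X W) >= 0,
where the columns of X are the points,
and coercivity turns this into the relative bounds T <= (K / ln t) N and
|N'| <= (K / ln t) N (contrast_mix_bounds).  The three claims follow.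

Prior.  The matrix under the trace is (1/t) (N' N^-1 - 2 I), and the bracket in
the prior does not change when a multiple of the identity is added to that
matrix.  Hence the prior is at most (1/t) sqrt (tr ((N' N^-1)^2)), and
N' N^-1 is similar to a symmetric matrix lying between - (K / ln t) I and
(K / ln t) I (trace_sqr_le, ref_prior_le).

Singularity.  T has rank at most r, because X has r rows, and r < n - 1.

Posterior.  Integrating over the mean, then over the variance, bounds the
likelihood by a constant times (det S * 1^T S^-1 1)^{-1/2} Q^{-(n-1)/2}, where S
is the correlation matrix and Q is the least value of
(y - b 1)^T S^-1 (y - b 1) over b (likelihood_le).  The product in the first
factor is n det (W^T S W) = n t^{-2(n-1)} det N, and det N is at least a multiple
of ln t: some diagonal entry of N grows at least like ln t while N stays above c I
(det_contrast_mix_ge).  As for Q, if W^T y is outside the range of W^T D W, some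
w in the kernel of T is not orthogonal to W^T y; for this w the form w^T N w
stays bounded, and the Cauchy-Schwarz inequality for S gives Q >= q0 t^2 with
q0 > 0.  The powers of t cancel and (ln t)^{-1/2} is left, to be multiplied by
the bound on the prior. *)

(** * Coercive symmetric matrices *)

Section QuadraticForms.
Variable R : rcfType.

Definition qform n (A : 'M[R]_n) (w : 'cV[R]_n) : R := (w^T *m A *m w) 0 0.

Definition sqnorm n (w : 'cV[R]_n) : R := (w^T *m w) 0 0.

Definition coercive n (A : 'M[R]_n) (c : R) : Prop :=
  forall w, c * sqnorm w <= qform A w.

Lemma sqnormE n (w : 'cV[R]_n) : sqnorm w = \sum_i w i 0 ^+ 2.
Proof. by rewrite /sqnorm mxE; apply: eq_bigr => i _; rewrite mxE. Qed.

Lemma sqnorm_ge0 n (w : 'cV[R]_n) : 0 <= sqnorm w.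
Proof. by rewrite sqnormE sumr_ge0// => i _; rewrite sqr_ge0. Qed.

Lemma sqnorm_gt0 n (w : 'cV[R]_n) : w != 0 -> 0 < sqnorm w.
Proof.
move=> w0; rewrite lt_neqAle sqnorm_ge0 andbT eq_sym; apply: contra w0.
rewrite sqnormE psumr_eq0; last by move=> i _; rewrite sqr_ge0.
move=> /allP h; apply/eqP/colP => i; rewrite mxE; apply/eqP.
by rewrite -sqrf_eq0; apply: h; rewrite mem_index_enum.
Qed.

Lemma sqnorm_delta n (i : 'I_n) : sqnorm (delta_mx i 0) = 1.
Proof. by rewrite /sqnorm trmx_delta mul_delta_mx mxE !eqxx. Qed.

Lemma qform_delta n (A : 'M[R]_n) i : qform A (delta_mx i 0) = A i i.
Proof. by rewrite /qform trmx_delta -rowE -colE !mxE. Qed.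

Lemma qformM n p (A : 'M[R]_n) (L : 'M[R]_(n, p)) w :
  qform (L^T *m A *m L) w = qform A (L *m w).
Proof. by rewrite /qform trmx_mul !mulmxA. Qed.

Lemma qformE n (A : 'M[R]_n) w :
  qform A w = \sum_i \sum_j w i 0 * w j 0 * A i j.
Proof.
rewrite /qform -mulmxA mxE; apply: eq_bigr => i _; rewrite mxE mxE mulr_sumr.
by apply: eq_bigr => j _; ring.
Qed.

Lemma qform_comb n (A : 'M[R]_n) (p q : R) (a u : 'cV[R]_n) :
  qform A (p *: a + q *: u) = p ^+ 2 * qform A a
    + p * q * ((a^T *m A *m u) 0 0 + (u^T *m A *m a) 0 0) + q ^+ 2 * qform A u.
Proof.
have -> : qform A (p *: a + q *: u) =
    ((p *: a^T + q *: u^T) *m A *m (p *: a + q *: u)) 0 0.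
  by rewrite /qform; do 3 f_equal; apply/matrixP => i j; rewrite !mxE.
rewrite !mulmxDl !mulmxDr -!scalemxAl -!scalemxAr /qform.
move: (a^T *m A *m a) (a^T *m A *m u) (u^T *m A *m a) (u^T *m A *m u).
by move=> X Y Z T; rewrite !mxE; ring.
Qed.

(** One step of block elimination. The Schur complement inherits the lower bound
because its form at w is the form of A at the vector that extends w and is
killed by the first row of L^T; extending a vector can only increase its norm.
*)
Lemma schur n (A : 'M[R]_(1 + n)) c : 0 < c -> A^T = A -> coercive A c ->
  exists (L : 'M[R]_(1 + n)) (S : 'M[R]_n),
    [/\ \det L = 1, S^T = S, coercive S c
      & A = L *m block_mx (A 0 0)%:M 0 0 S *m L^T].
Proof.
move=> c0 As Ac.
have a0 : 0 < A 0 0.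
  apply: (lt_le_trans c0); have := Ac (delta_mx 0 0).
  by rewrite sqnorm_delta mulr1 qform_delta.
set a := A 0 0 in a0 *; set b : 'rV[R]_n := ursubmx A.
have Aul : ulsubmx A = a%:M.
  rewrite [LHS]mx11_scalar !mxE; congr (A _ _)%:M; exact/val_inj.
have Adl : dlsubmx A = b^T by rewrite trmx_ursub As.
pose L : 'M[R]_(1 + n) := block_mx 1%:M 0 (a^-1 *: b^T) 1%:M.
pose S := drsubmx A - a^-1 *: (b^T *m b).
have LT : L^T = block_mx 1%:M (a^-1 *: b) 0 1%:M.
  by rewrite tr_block_mx !tr_scalar_mx trmx0 linearZ/= trmxK.
have AE : A = L *m block_mx a%:M 0 0 S *m L^T.
  have aa : a * a^-1 = 1 by rewrite divff// gt_eqF.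
  rewrite LT /L !mulmx_block !(mulmx0, mul0mx, mulmx1, mul1mx, addr0, add0r).
  rewrite -[LHS]submxK Aul Adl; congr block_mx.
  - by rewrite mul_scalar_mx scalerA aa scale1r.
  - by rewrite mul_mx_scalar scalerA aa scale1r.
  - by rewrite mul_mx_scalar scalerA aa scale1r -scalemxAr /S addrC subrK.
exists L, S; split=> //.
- by rewrite det_lblock !det1 mulr1.
- rewrite /S linearB/= trmx_drsub As; congr (_ - _).
  by rewrite linearZ/= trmx_mul trmxK.
- move=> w; pose u : 'cV[R]_(1 + n) := col_mx (- (a^-1 *: (b *m w))) w.
  have Lu : L^T *m u = col_mx 0 w.
    by rewrite LT mul_block_col !mul1mx mul0mx add0r -scalemxAl addNr.
  have := Ac u; rewrite [X in qform X _]AE -{1}[L]trmxK qformM Lu.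
  rewrite /qform tr_col_mx trmx0 mul_row_block mul_row_col.
  rewrite !mul0mx mulmx0 !add0r; apply: le_trans.
  apply: ler_wpM2l; first exact: ltW.
  rewrite /sqnorm /u tr_col_mx mul_row_col [leRHS]mxE lerDr.
  exact: sqnorm_ge0.
Qed.

Lemma det_coercive n (A : 'M[R]_n) c :
  0 < c -> A^T = A -> coercive A c -> c ^+ n <= \det A.
Proof.
elim: n A => [|n IHn] A c0 As Ac; first by rewrite det_mx00.
have [L [S [detL Ss Sc ->]]] := schur c0 As Ac.
rewrite !det_mulmx det_tr detL mulr1 mul1r (@det_ublock _ 1 n) det_scalar1 exprS.
apply: ler_pM; [exact: ltW|by rewrite exprn_ge0 ?ltW| |exact: IHn].
by have := Ac (delta_mx 0 0); rewrite sqnorm_delta mulr1 qform_delta.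
Qed.

(** The first pivot is the corner entry itself, and the others are the pivots of
a Schur complement that is still bounded below by c. *)
Lemma det_coercive_diag0 n (A : 'M[R]_(1 + n)) c :
  0 < c -> A^T = A -> coercive A c -> A 0 0 * c ^+ n <= \det A.
Proof.
move=> c0 As Ac; have [L [S [detL Ss Sc AE]]] := schur c0 As Ac.
rewrite [in leRHS]AE !det_mulmx det_tr detL mulr1 mul1r (@det_ublock _ 1 n).
rewrite det_scalar1 ler_wpM2l ?det_coercive//.
by have := Ac (delta_mx 0 0); rewrite sqnorm_delta mulr1 qform_delta; lra.
Qed.

(** Conjugating by a transposition moves any diagonal entry to the corner. *)
Lemma det_coercive_diag n (A : 'M[R]_n) c i :
  0 < c -> A^T = A -> coercive A c -> A i i * c ^+ n.-1 <= \det A.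
Proof.
case: n A i => [|n] A i c0 As Ac; first by case: i.
 pose P : 'M[R]_n.+1 := perm_mx (tperm 0 i).
have PT : P^T = P by rewrite tr_perm_mx tpermV.
have PP : P *m P = 1%:M by rewrite -perm_mxM tperm2 perm_mx1.
have PE (B : 'M[R]_n.+1) k l :
    (P^T *m B *m P) k l = B (tperm 0 i k) (tperm 0 i l).
  have -> : P^T *m B *m P = col_perm (tperm 0 i) (row_perm (tperm 0 i) B).
    by rewrite col_permE row_permE tpermV PT.
  by rewrite !mxE.
have -> : \det A = \det (P^T *m A *m P).
  by rewrite !det_mulmx det_tr mulrAC -det_mulmx PP det1 mul1r.
have := @det_coercive_diag0 n (P^T *m A *m P) c c0.
rewrite PE tpermL; apply.
- by rewrite !trmx_mul As trmxK mulmxA.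
- move=> w; rewrite qformM; apply: le_trans (Ac _).
  by rewrite /sqnorm trmx_mul PT -mulmxA (mulmxA P) PP mul1mx.
Qed.

Lemma coercive_unitmx n (A : 'M[R]_n) c :
  0 < c -> A^T = A -> coercive A c -> A \in unitmx.
Proof.
move=> c0 As Ac; rewrite unitmxE unitfE gt_eqF//.
by apply: lt_le_trans (det_coercive c0 As Ac); rewrite exprn_gt0.
Qed.

Lemma cholesky n (A : 'M[R]_n) c :
  0 < c -> A^T = A -> coercive A c -> exists C : 'M[R]_n, A = C^T *m C.
Proof.
elim: n A => [|n IHn] A c0 As Ac; first by exists 1%:M; rewrite !flatmx0.
have [L [S [detL Ss Sc AE]]] := schur c0 As Ac.
have [C SE] := IHn S c0 Ss Sc.
have a0 : 0 <= A 0 0.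
  by have := Ac (delta_mx 0 0); rewrite sqnorm_delta mulr1 qform_delta; lra.
pose G : 'M[R]_(1 + n) := block_mx (Num.sqrt (A 0 0))%:M 0 0 C.
have GE : G^T *m G = block_mx (A 0 0)%:M 0 0 S.
  rewrite tr_block_mx mulmx_block !(trmx0, mulmx0, mul0mx, addr0, add0r) -SE.
  by rewrite tr_scalar_mx -scalar_mxM -expr2 sqr_sqrtr.
exists (G *m L^T : 'M[R]_(1 + n)).
by rewrite (trmx_mul G) trmxK mulmxA -(mulmxA L) GE.
Qed.

(** The Cauchy-Schwarz inequality for the inner product defined by A, applied to
a and A^-1 z: expand the form of A at Z a - b u, where u = A^-1 z and Z, b are
the form of A^-1 at z and the product a^T z. *)
Lemma qform_cauchy n (A : 'M[R]_n) c (a z : 'cV[R]_n) :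
    0 < c -> A^T = A -> coercive A c ->
  ((a^T *m z) 0 0) ^+ 2 <= qform A a * qform (invmx A) z.
Proof.
move=> c0 As Ac; have uA := coercive_unitmx c0 As Ac.
have Ais : (invmx A)^T = invmx A by rewrite trmx_inv As.
pose u := invmx A *m z.
have zE : z = A *m u by rewrite mulmxA mulmxV// mul1mx.
set b := (a^T *m z) 0 0; set Z := qform (invmx A) z.
have ZE : Z = qform A u.
  by rewrite /Z /u -qformM Ais mulVmx// mul1mx.
have [u0|u0] := eqVneq u 0.
  have z0 : z = 0 by rewrite zE u0 mulmx0.
  by rewrite /b /Z /qform z0 !mulmx0 !mxE expr0n/= mulr0.
have Z0 : 0 < Z.
  by rewrite ZE; apply: lt_le_trans (Ac _); rewrite mulr_gt0// sqnorm_gt0.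
have bE : b = (a^T *m A *m u) 0 0 by rewrite /b zE mulmxA.
have bE' : b = (u^T *m A *m a) 0 0.
  rewrite bE -[in RHS](trmxK (u^T *m A *m a)) [RHS]mxE.
  by rewrite (trmx_mul (u^T *m A)) (trmx_mul u^T) trmxK As mulmxA.
have : 0 <= qform A (Z *: a + (- b) *: u).
  by apply: le_trans (Ac _); rewrite mulr_ge0 ?sqnorm_ge0// ltW.
rewrite qform_comb -bE -bE' -ZE => h.
rewrite -subr_ge0 -(pmulr_rge0 _ Z0); apply: le_trans h _.
by rewrite le_eqVlt; apply/orP; left; apply/eqP; ring.
Qed.

(** Polarization. *)
Lemma entry_le_of_qform n (S : 'M[R]_n) k : S^T = S ->
  (forall w, `|qform S w| <= k * sqnorm w) -> forall i j, `|S i j| <= k.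
Proof.
move=> Ss Sk i j; pose e l : 'cV[R]_n := delta_mx l 0.
have eSe p q : ((e p)^T *m S *m e q) 0 0 = S p q.
  by rewrite trmx_delta -rowE -colE !mxE.
have Sji : S j i = S i j by rewrite -[in LHS]Ss mxE.
have sqn p q : sqnorm (p *: e i + q *: e j)
             = p ^+ 2 + 2 * p * q * ((e i)^T *m e j) 0 0 + q ^+ 2.
  have qf1 w : sqnorm w = qform (1%:M : 'M[R]_n) w by rewrite /qform mulmx1.
  rewrite qf1 qform_comb -!qf1 !sqnorm_delta !mulmx1.
  have -> : ((e j)^T *m e i) 0 0 = ((e i)^T *m e j) 0 0.
    by rewrite -[in LHS](trmxK (e i)) -trmx_mul mxE.
  by ring.
have qE p q : qform S (p *: e i + q *: e j)
            = p ^+ 2 * S i i + 2 * p * q * S i j + q ^+ 2 * S j j.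
  by rewrite qform_comb !eSe Sji !qform_delta; ring.
have := Sk (1 *: e i + 1 *: e j); have := Sk (1 *: e i + (-1) *: e j).
rewrite !sqn !qE !ler_norml => /andP[h1 h2] /andP[h3 h4].
by apply/andP; split; lra.
Qed.

(** With A = C^T C, the matrix B A^-1 is similar to the symmetric matrix C^-T B
C^-1, whose entries are at most k in absolute value. *)
Lemma trace_sqr_le n (A B : 'M[R]_n) c k :
    0 < c -> A^T = A -> coercive A c -> B^T = B ->
    (forall w, `|qform B w| <= k * qform A w) ->
  \tr ((B *m invmx A) *m (B *m invmx A)) <= n%:R ^+ 2 * k ^+ 2.
Proof.
move=> c0 As Ac Bs BA; have uA := coercive_unitmx c0 As Ac.
have [C AE] := cholesky c0 As Ac.
have uC : C \in unitmx by move: uA; rewrite AE unitmx_mul => /andP[].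
pose S := (invmx C)^T *m B *m invmx C.
have AiE : invmx A = invmx C *m (invmx C)^T.
  rewrite -[RHS](mulKmx uA) -[LHS]mulmx1; congr (_ *m _).
  rewrite AE -mulmxA (mulmxA C) mulmxV// mul1mx trmx_inv mulmxV//.
  by rewrite unitmx_tr.
have Ss : S^T = S by rewrite !trmx_mul trmxK Bs mulmxA.
have Sk i j : `|S i j| <= k.
  apply: entry_le_of_qform => // w; rewrite qformM; apply: le_trans (BA _) _.
  by rewrite AE -[C^T]mulmx1 qformM mulKVmx// /qform mulmx1.
have -> : \tr ((B *m invmx A) *m (B *m invmx A)) = \tr (S *m S).
  rewrite AiE; set D := invmx C; rewrite /S -/D.
  have -> : B *m (D *m D^T) *m (B *m (D *m D^T)) =
            (B *m D *m D^T *m B *m D) *m D^T by rewrite !mulmxA.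
  by rewrite mxtrace_mulC !mulmxA.
rewrite /mxtrace; apply: (@le_trans _ _ (\sum_(i < n) \sum_(j < n) k ^+ 2)).
  apply: ler_sum => i _; rewrite mxE; apply: ler_sum => j _.
  apply: le_trans (ler_norm _) _.
  by rewrite normrM expr2 ler_pM.
by rewrite !sumr_const !card_ord -mulrnA -[leLHS]mulr_natl natrM expr2.
Qed.

End QuadraticForms.

(** * Integrability on the half-line *)

Section RealIntegrable.
Context d (T : measurableType d) (R : realType) (mu : {measure set T -> \bar R}).

Lemma integrableRD (D : set T) (f g : T -> R) : measurable D ->
  mu.-integrable D (EFin \o f) -> mu.-integrable D (EFin \o g) ->
  mu.-integrable D (EFin \o (fun s => f s + g s)).
Proof. by move=> mD fi gi; exact: (integrableD mD fi gi). Qed.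

Lemma integrableRZ (D : set T) (k : R) (f : T -> R) : measurable D ->
  mu.-integrable D (EFin \o f) -> mu.-integrable D (EFin \o (fun s => k * f s)).
Proof. by move=> mD fi; exact: (integrableZl mD k fi). Qed.

Lemma integrableRB (D : set T) (f g : T -> R) : measurable D ->
  mu.-integrable D (EFin \o f) -> mu.-integrable D (EFin \o g) ->
  mu.-integrable D (EFin \o (fun s => f s - g s)).
Proof. by move=> mD fi gi; exact: (integrableB mD fi gi). Qed.

Lemma integrableR_sum (I : Type) (l : seq I) (D : set T) (F : I -> T -> R) :
  measurable D -> (forall i, mu.-integrable D (EFin \o F i)) ->
  mu.-integrable D (EFin \o (fun s => \sum_(i <- l) F i s)).
Proof.
move=> mD Fi; rewrite (_ : EFin \o _ = (fun s => \sum_(i <- l) (F i s)%:E)%E).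
  by apply: integrable_sum => // i _; exact: Fi.
by apply/funext => s /=; rewrite sumEFin.
Qed.

Lemma Rintegral_sum (I : Type) (l : seq I) (D : set T) (F : I -> T -> R) :
  measurable D -> (forall i, mu.-integrable D (EFin \o F i)) ->
  Rintegral mu D (fun s => \sum_(i <- l) F i s) =
  \sum_(i <- l) Rintegral mu D (F i).
Proof.
move=> mD Fi; elim: l => [|i l IHl].
  by rewrite big_nil; under eq_Rintegral do rewrite big_nil; rewrite Rintegral_cst// mul0r.
rewrite big_cons -IHl -RintegralD//; last exact: integrableR_sum.
by apply: eq_Rintegral => s _; rewrite big_cons.
Qed.

End RealIntegrable.

Section ExponentialIntegrals.
Variable R : realType.
Notation mu := (@lebesgue_measure R).

Lemma continuous_measurable_0y (f : R -> R) :
  {in `](0 : R), +oo[, continuous f} -> measurable_fun `](0 : R), +oo[ f.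
Proof.
move=> cf; apply: open_continuous_measurable_fun; first exact: interval_open.
by move=> x; rewrite inE => xI; exact: cf.
Qed.

Lemma integral_exp (c : R) : 0 < c ->
  (\int[mu]_(s in `](0%R : R), +oo[) (expR (- (c * s)))%:E = (c^-1)%:E)%E.
Proof.
move=> c0.
have cexp : continuous (fun s : R => expR (- (c * s))).
  move=> x; apply: continuous_comp; last exact: continuous_expR.
  by apply: cvgN; apply: cvgM; [exact: cvg_cst|exact: cvg_id].
rewrite integral_itv_obnd_cbnd; last first.
  apply/measurable_EFinP; apply: measurable_funTS.
  exact: continuous_measurable_fun.
rewrite (@ge0_continuous_FTC2y _ _ (fun s => - c^-1 * expR (- (c * s))) _ 0)//.
- by rewrite mulr0 oppr0 expR0 mulr1 EFinN oppeK add0e.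
- exact: continuous_subspaceT.
- rewrite -(mulr0 (- c^-1)); apply: cvgMr.
  have -> : (fun s => expR (- (c * s))) = (fun z => expR (- z)) \o ( *%R c).
    by [].
  apply: (@cvg_comp _ _ _ _ _ _ (pinfty_nbhs R)); last exact: cvgr_expR.
  exact: gt0_cvgMry.
- apply: cvg_at_right_filter; apply: cvgMr; exact: cexp.
- move=> x _; rewrite derive1E derive_val.
  rewrite /GRing.scale/= mulr1.
  by field; rewrite gt_eqF.
Qed.

Lemma integrable_exp (c : R) : 0 < c ->
  mu.-integrable `](0 : R), +oo[ (EFin \o (fun s => expR (- (c * s)))).
Proof.
move=> c0; apply/integrableP; split.
  apply/measurable_EFinP; apply: measurable_funTS.
  apply: continuous_measurable_fun => x.
  apply: continuous_comp; last exact: continuous_expR.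
  by apply: cvgN; apply: cvgM; [exact: cvg_cst|exact: cvg_id].
under eq_integral do rewrite /= ger0_norm ?expR_ge0//.
by rewrite integral_exp// ltry.
Qed.

Lemma integrable_exp_bound (f : R -> R) (K c : R) : 0 < c ->
  {in `](0 : R), +oo[, continuous f} ->
  (forall s, 0 < s -> `|f s| <= K * expR (- (c * s))) ->
  mu.-integrable `](0 : R), +oo[ (EFin \o f).
Proof.
move=> c0 cf fK.
apply: (@le_integrable _ _ _ mu _ _ _ (fun s => K%:E * (expR (- (c * s)))%:E)%E) => //.
- by apply/measurable_EFinP; exact: continuous_measurable_0y.
- move=> s /=; rewrite in_itv/= andbT => s0; rewrite lee_fin.
  by rewrite (le_trans (fK _ s0))// ler_norm.
- by apply: integrableZl => //; exact: integrable_exp.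
Qed.

End ExponentialIntegrals.

(** * The mixture integral and its derivative *)

Section GaussianMixture.
Variable R : realType.
Notation mu := (@lebesgue_measure R).

Definition mixker (q e s : R) : R := expR (- (e * s + q / s)).

Definition mixint (q e : R) : R :=
  Rintegral mu `](0 : R), +oo[ (mixker q e).

(** The first moment of the mixture; up to sign, the derivative of mixint q in
e. *)
Definition mixint1 (q e : R) : R :=
  Rintegral mu `](0 : R), +oo[ (fun s => s * mixker q e s).

Lemma continuous_mixker (q e : R) : {in `](0 : R), +oo[, continuous (mixker q e)}.
Proof.
move=> x; rewrite in_itv/= andbT => x0.
apply: continuous_comp; last exact: continuous_expR.
apply: cvgN; apply: cvgD.
  by apply: cvgM; [exact: cvg_cst|exact: cvg_id].
by apply: cvgM; [exact: cvg_cst|apply: cvgV; [rewrite gt_eqF|exact: cvg_id]].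
Qed.

Lemma mixker_ge0 q e s : 0 <= mixker q e s.
Proof. exact: expR_ge0. Qed.

Lemma mixker_le (q e s : R) : 0 <= q -> 0 < s -> mixker q e s <= expR (- (e * s)).
Proof.
move=> q0 s0; rewrite ler_expR lerN2 lerDl divr_ge0// ltW//.
Qed.

Lemma mul_exp_le (c s : R) : 0 < c -> s * expR (- (c * s)) <= c^-1.
Proof.
move=> c0; rewrite expRN ler_pdivrMr ?expR_gt0// ler_pdivlMl//.
by apply: le_trans (expR_ge1Dx _); rewrite lerDr.
Qed.

Lemma integrable_mixker (q e : R) : 0 <= q -> 0 < e ->
  mu.-integrable `](0 : R), +oo[ (EFin \o mixker q e).
Proof.
move=> q0 e0; apply: (@integrable_exp_bound _ _ 1 e) => //.
  exact: continuous_mixker.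
by move=> s s0; rewrite mul1r ger0_norm ?mixker_ge0// mixker_le.
Qed.

(** Half of the exponential decay absorbs the factor s. *)
Lemma mul_mixker_le (q e c s : R) : 0 <= q -> 0 < c -> 2 * c <= e -> 0 < s ->
  s * mixker q e s <= c^-1 * expR (- (c * s)).
Proof.
move=> q0 c0 ce s0.
apply: (@le_trans _ _ (s * expR (- (c * s)) * expR (- (c * s)))); last first.
  by rewrite ler_wpM2r ?expR_ge0// mul_exp_le.
rewrite -mulrA -expRD ler_pM2l//.
apply: le_trans (mixker_le _ q0 s0) _; rewrite ler_expR.
by nra.
Qed.

Lemma integrable_mul_mixker (q e : R) : 0 <= q -> 0 < e ->
  mu.-integrable `](0 : R), +oo[ (EFin \o (fun s => s * mixker q e s)).
Proof.
move=> q0 e0; apply: (@integrable_exp_bound _ _ (e / 2)^-1 (e / 2)).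
- by rewrite divr_gt0.
- by move=> x xI; apply: cvgM; [exact: cvg_id|exact: continuous_mixker].
- move=> s s0; rewrite ger0_norm ?mulr_ge0 ?mixker_ge0 ?(ltW s0)//.
  by apply: mul_mixker_le => //; [rewrite divr_gt0|lra].
Qed.

Lemma is_derive_mixker (q s e : R) :
  is_derive e 1 (fun t => mixker q t s) (- (s * mixker q e s)).
Proof.
rewrite /mixker; apply: is_derive_eq.
by rewrite /GRing.scale/=; ring.
Qed.

(** Differentiation under the integral sign, on the neighborhood ]e/2, 2e[ of e,
where the derivative of the integrand is dominated by a multiple of exp (- (e/4)
s). *)
Lemma is_derive_mixint (q e : R) : 0 <= q -> 0 < e ->
  is_derive e 1 (mixint q) (- mixint1 q e).
Proof.
move=> q0 e0; pose f (t s : R) := mixker q t s.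
have eI : (`](e / 2), (2 * e)[%classic : set R) e.
  by rewrite /= in_itv/=; apply/andP; split; lra.
have h2 : forall t : R, (`](e / 2), (2 * e)[%classic : set R) t -> e / 2 < t.
  by move=> t; rewrite /= in_itv/= => /andP[].
have intf t : (`](e / 2), (2 * e)[%classic : set R) t ->
    mu.-integrable `](0 : R), +oo[ (EFin \o f t).
  by move=> /h2 te; apply: integrable_mixker => //; apply: lt_trans te; lra.
have df t s : (`](e / 2), (2 * e)[%classic : set R) t ->
    (`](0 : R), +oo[%classic : set R) s -> derivable (f ^~ s) t 1.
  by move=> _ _; have [] := is_derive_mixker q s t.
pose G s : R := (e / 4)^-1 * expR (- ((e / 4) * s)).
have G0 s : 0 <= G s by rewrite mulr_ge0 ?expR_ge0// invr_ge0; lra.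
have iG : mu.-integrable `](0 : R), +oo[ (EFin \o G).
  apply: (@integrableZl _ _ _ mu _ _ (e / 4)^-1 (EFin \o _)) => //.
  by apply: integrable_exp; lra.
have part t s : partial1of2 f t s = - (s * mixker q t s).
  by rewrite partial1of2E; have [_ ->] := is_derive_mixker q s t.
have Gub t s : (`](e / 2), (2 * e)[%classic : set R) t ->
    (`](0 : R), +oo[%classic : set R) s -> `|partial1of2 f t s| <= G s.
  move=> /h2 te; rewrite /= in_itv/= andbT => s0.
  rewrite part normrN ger0_norm ?mulr_ge0 ?mixker_ge0 ?(ltW s0)//.
  by apply: mul_mixker_le => //; lra.
split.
  exact: (@derivable_under_integral _ _ _ mu f _ _ e (e/2) (2*e) eI intf df G).
rewrite -derive1E.
rewrite (@differentiation_under_integral _ _ _ mu f _ _ e (e/2) (2*e) eI intf df G)//.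
rewrite /mixint1 -mulN1r -RintegralZl//; last exact: integrable_mul_mixker.
by apply: eq_Rintegral => s _; rewrite part mulN1r.
Qed.

Lemma mixint0 (e : R) : 0 < e -> mixint 0 e = e^-1.
Proof.
move=> e0; rewrite /mixint /Rintegral.
under eq_integral do rewrite /mixker mul0r addr0.
by rewrite integral_exp.
Qed.

(** Comes from differentiating 1/e instead of computing the integral of s exp (-
e s). *)
Lemma mixint10 (e : R) : 0 < e -> mixint1 0 e = (e ^+ 2)^-1.
Proof.
move=> e0; have [_ h] := is_derive_mixint (lexx 0) e0.
apply: oppr_inj; rewrite -h.
rewrite (@near_eq_derive _ _ _ _ (fun x : R => x^-1)).
  by rewrite deriveV ?gt_eqF// derive_id /GRing.scale/= mulr1.
near=> t; apply: mixint0; near: t; exact: lt_nbhsr.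
Unshelve. all: by end_near. Qed.

End GaussianMixture.

(** * The mixture integral near 0 *)

Section MixtureAsymptotics.
Variable R : realType.
Notation mu := (@lebesgue_measure R).

(** The bound by x^2 comes from exp (- x) <= 1 / (1 + x). *)
Lemma expR_taylor1 (x : R) : 0 <= x ->
  [/\ 0 <= expR (- x) - 1 + x, expR (- x) - 1 + x <= x
    & expR (- x) - 1 + x <= x ^+ 2].
Proof.
move=> x0; have h0 := expR_ge1Dx (- x).
have h1 : expR (- x) <= 1 by rewrite -[leRHS]expR0 ler_expR; lra.
have h2 : expR (- x) <= (1 + x)^-1.
  by rewrite expRN lef_pV2 ?posrE ?expR_gt0 ?expR_ge1Dx//; lra.
have h3 : (1 + x)^-1 <= 1 - x + x ^+ 2.
  rewrite -[leLHS]mul1r ler_pdivrMr; last lra.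
  have -> : (1 - x + x ^+ 2) * (1 + x) = 1 + x ^+ 3 by ring.
  by rewrite lerDl exprn_ge0.
by split; lra.
Qed.

(** With x = q / s, the left-hand side is exp (- e s) s (exp (- x) - 1 + x), so
it is at most q and at most q^2 / s. The first bound serves where s <= e^{-1/2},
the second elsewhere; both are written with exponentials so that only their
integrals are needed. *)
Lemma mixker_remainder (q e s : R) : 0 <= q -> 0 < e -> 0 < s ->
  `|s * mixker q e s - s * mixker 0 e s + q * mixker 0 e s|
  <= q * expR 1 * expR (- (Num.sqrt e * s))
     + q ^+ 2 * Num.sqrt e * expR (- (e * s)).
Proof.
move=> q0 e0 s0.
have r0 : 0 < Num.sqrt e by rewrite sqrtr_gt0.
have [t0 t1 t2] := expR_taylor1 (divr_ge0 q0 (ltW s0)).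
set r := expR (- (q / s)) - 1 + q / s in t0 t1 t2.
have -> : s * mixker q e s - s * mixker 0 e s + q * mixker 0 e s
          = s * r * expR (- (e * s)).
  rewrite /mixker mul0r addr0 opprD expRD /r.
  by field; rewrite gt_eqF.
have es1 : expR (- (e * s)) <= 1.
  by rewrite -[leRHS]expR0 ler_expR oppr_le0 mulr_ge0// ltW.
rewrite ger0_norm; last by rewrite !mulr_ge0 ?expR_ge0// ltW.
(* Here s <= e^{-1/2}, so that expR 1 * expR (- (Num.sqrt e * s)) >= 1. *)
have [rs|rs] := leP (Num.sqrt e * s) 1.
  apply: (@le_trans _ _ (q * expR 1 * expR (- (Num.sqrt e * s)))); last first.
    by rewrite lerDl !mulr_ge0 ?expR_ge0// ltW.
  rewrite -[leRHS]mulrA -expRD; apply: ler_pM; rewrite ?expR_ge0//.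
  - by rewrite mulr_ge0// ltW.
  - rewrite mulrC -ler_pdivlMr//.
  - apply: le_trans es1 _; rewrite -[leLHS]expR0 ler_expR; lra.
apply: (@le_trans _ _ (q ^+ 2 * Num.sqrt e * expR (- (e * s)))); last first.
  by rewrite lerDr !mulr_ge0 ?expR_ge0.
rewrite ler_wpM2r ?expR_ge0//.
apply: (@le_trans _ _ (q ^+ 2 / s)).
  apply: (@le_trans _ _ (s * (q / s) ^+ 2)); first by rewrite ler_pM2l.
  by rewrite le_eqVlt; apply/orP; left; apply/eqP; field; rewrite gt_eqF.
by rewrite ler_wpM2l ?sqr_ge0// -[leLHS]mul1r ler_pdivrMr// ltW.
Qed.

Definition mix_cst (q : R) : R := q * expR 1 + q ^+ 2.

(** The quantity is e times the integral of the left-hand side of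
mixker_remainder, because 1 / e^2 and 1 / e are the integrals of s exp (- e s)
and of exp (- e s). *)
Lemma mixint1_asymp (q e : R) : 0 <= q -> 0 < e ->
  `|e * mixint1 q e - e^-1 + q| <= mix_cst q * Num.sqrt e.
Proof.
move=> q0 e0; have r0 : 0 < Num.sqrt e by rewrite sqrtr_gt0.
have rr : Num.sqrt e * Num.sqrt e = e by rewrite -expr2 sqr_sqrtr// ltW.
pose g (s : R) := s * mixker q e s - s * mixker 0 e s + q * mixker 0 e s.
pose h (s : R) := q * expR 1 * expR (- (Num.sqrt e * s))
     + q ^+ 2 * Num.sqrt e * expR (- (e * s)).
have i1 := integrable_mul_mixker q0 e0.
have i2 := integrable_mul_mixker (lexx 0) e0.
have i3 := integrable_mixker (lexx 0) e0.
have m0y : (R.-ocitv.-measurable).-sigma.-measurable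
  (`](0 : R), +oo[%classic : set R) by [].
have i12 := integrableRB m0y i1 i2.
have i3q := integrableRZ q m0y i3.
have ig : mu.-integrable `](0 : R), +oo[ (EFin \o g).
  exact: (integrableRD m0y i12 i3q).
have j1 := integrableRZ (q * expR 1) m0y
  (integrable_exp r0).
have j2 := integrableRZ (q ^+ 2 * Num.sqrt e) m0y
  (integrable_exp e0).
have ih : mu.-integrable `](0 : R), +oo[ (EFin \o h).
  exact: (integrableRD m0y j1 j2).
have gE : Rintegral mu `](0 : R), +oo[ g =
    mixint1 q e - mixint1 0 e + q * mixint 0 e.
  rewrite /g RintegralD//.
  by rewrite RintegralB// RintegralZl.
have hE : Rintegral mu `](0 : R), +oo[ h = mix_cst q / Num.sqrt e.
  rewrite /h RintegralD// !RintegralZl//; [|exact: integrable_exp..].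
  rewrite /Rintegral !integral_exp//= /mix_cst mulrDl; congr (_ + _).
  by rewrite -[in e^-1]rr; field; rewrite gt_eqF.
have -> : e * mixint1 q e - e^-1 + q = e * Rintegral mu `](0 : R), +oo[ g.
  by rewrite gE mixint0// mixint10//; field; rewrite gt_eqF.
have -> : mix_cst q * Num.sqrt e = e * (mix_cst q / Num.sqrt e).
  by rewrite -[X in _ = X * _]rr; field; rewrite gt_eqF.
rewrite normrM gtr0_norm// ler_pM2l// -hE.
apply: le_trans (le_normr_Rintegral _ ig) _ => //.
apply: le_Rintegral => //.
  exact: (integrable_norm ig).
by move=> s; rewrite /= in_itv/= andbT => s0; exact: mixker_remainder.
Qed.

(** f + 2 C sqrt is nondecreasing. *)
Lemma le_of_derive_sqrt (f df : R -> R) (C : R) : 0 <= C ->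
  (forall x : R, 0 < x -> is_derive x 1 f (df x)) ->
  (forall x, 0 < x -> - (C / Num.sqrt x) <= df x) ->
  forall e, 0 < e <= 1 -> f e <= f 1 + 2 * C.
Proof.
move=> C0 fd dfC e /andP[e0]; rewrite le_eqVlt => /predU1P[->|e1].
  by rewrite lerDl mulr_ge0.
pose dg (x : R) := df x + (2 * C) * (2 * Num.sqrt x)^-1.
pose g := f + (2 * C) *: (@Num.sqrt R : R -> R).
have gd (x : R) : 0 < x -> is_derive x 1 g (dg x).
  move=> x0; have d1 := fd x x0; have d2 := is_derive1_sqrt x0.
  exact: is_deriveD.
have [||c] := @MVT R g dg e 1 e1.
- by move=> x; rewrite in_itv/= => /andP[ex _]; apply: gd; lra.
- apply: derivable_within_continuous => x; rewrite in_itv/= => /andP[ex _].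
  by have [] := gd x (lt_le_trans e0 ex).
rewrite in_itv/= => /andP[ec c1] gE.
have c0 : 0 < c by lra.
have r0 : 0 < Num.sqrt c by rewrite sqrtr_gt0.
have dg0 : 0 <= dg c.
  have := dfC c c0; rewrite /dg.
  have -> : (2 * C) * (2 * Num.sqrt c)^-1 = C / Num.sqrt c.
    by field; rewrite gt_eqF.
  by lra.
have : 0 <= g 1 - g e by rewrite gE mulr_ge0//; lra.
rewrite /g !fctE sqrtr1 /GRing.scale/= mulr1.
have := mulr_ge0 C0 (sqrtr_ge0 e); lra.
Qed.

(** By mixint1_asymp the difference has a derivative of size O(e^{-1/2}), which
is integrable at 0. *)
Lemma mixint_asymp (q : R) : 0 <= q ->
  exists C : R, forall e : R, 0 < e <= 1 ->
    `|mixint q e - e^-1 - q * ln e| <= C.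
Proof.
move=> q0; pose C0 := mix_cst q.
pose f (e : R) := mixint q e - e^-1 - q * ln e.
pose df (e : R) := - (mixint1 q e) + (e ^+ 2)^-1 - q / e.
have fd (e : R) : 0 < e -> is_derive e 1 f (df e).
  move=> e0; have d1 := is_derive_mixint q0 e0.
  have d2 := is_derive1_ln e0.
  have d3 : is_derive e 1 (fun x : R => x^-1) (- (e ^+ 2)^-1).
    split; first by apply: derivableV; rewrite ?gt_eqF.
    by rewrite deriveV ?gt_eqF// derive_id /GRing.scale/= mulr1.
  rewrite /f; apply: is_derive_eq.
  by rewrite /df /GRing.scale/=; ring.
have dfb (e : R) : 0 < e -> `|df e| <= C0 / Num.sqrt e.
  move=> e0; have r0 : 0 < Num.sqrt e by rewrite sqrtr_gt0.
  have rr : Num.sqrt e * Num.sqrt e = e by rewrite -expr2 sqr_sqrtr// ltW.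
  have -> : df e = - e^-1 * (e * mixint1 q e - e^-1 + q).
    by rewrite /df; field; rewrite gt_eqF.
  rewrite normrM normrN normfV (gtr0_norm e0) ler_pdivrMl//.
  apply: le_trans (mixint1_asymp q0 e0) _.
  have -> : e * (C0 / Num.sqrt e) = C0 * Num.sqrt e.
    by rewrite -[X in X * _ = _]rr; field; rewrite gt_eqF.
  exact: lexx.
have C00 : 0 <= C0 by rewrite addr_ge0 ?mulr_ge0 ?expR_ge0.
exists (`|f 1| + 2 * C0) => e e01; have e0 : 0 < e by case/andP: e01.
have h1 : f e <= f 1 + 2 * C0.
  apply: (@le_of_derive_sqrt f df) => // x x0.
  by have := dfb x x0; rewrite ler_norml => /andP[].
have h2 : - f e <= - f 1 + 2 * C0.
  apply: (@le_of_derive_sqrt (- f) (fun x => - df x)) => // x x0.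
    by apply: is_deriveN; exact: fd.
  by rewrite lerN2; have := dfb x x0; rewrite ler_norml => /andP[].
rewrite -/(f e) ler_norml; have := ler_norm (f 1); have := ler_norm (- f 1).
by rewrite normrN => h3 h4; apply/andP; split; lra.
Qed.

End MixtureAsymptotics.

(** * The Matern correlation as a Gaussian mixture *)

Section MaternMixture.
Variable R : realType.
Notation mu := (@lebesgue_measure R).

Lemma is_derive_inversion (c s : R) : 0 < s ->
  is_derive s 1 (fun x : R => c / x) (- (c / s ^+ 2)).
Proof.
move=> s0; have d3 : is_derive s 1 (fun x : R => x^-1) (- (s ^+ 2)^-1).
  split; first by apply: derivableV; rewrite ?gt_eqF.
  by rewrite deriveV ?gt_eqF// derive_id /GRing.scale/= mulr1.
have h : is_derive s 1 (c *: (fun x : R => x^-1)) (c *: - (s ^+ 2)^-1).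
  exact: is_deriveZ.
by apply: (is_derive_eq h); rewrite /GRing.scale/= mulrN.
Qed.

Lemma derive1_inversion (c s : R) : 0 < s ->
  (fun x : R => c / x)^`()%classic s = - (c / s ^+ 2).
Proof.
by move=> s0; rewrite derive1E; have [_ ->] := is_derive_inversion c s0.
Qed.

Lemma continuous_inversion_deriv (c : R) :
  {in `](0 : R), +oo[, continuous (fun s : R => c / s ^+ 2)}.
Proof.
move=> s; rewrite in_itv/= andbT => s0.
apply: cvgM; first exact: cvg_cst.
apply: cvgV; first by rewrite expf_neq0// gt_eqF.
exact: exprn_continuous.
Qed.

Lemma continuous_inversion (c : R) :
  {in `](0 : R), +oo[, continuous (fun s : R => c / s)}.
Proof.
move=> s; rewrite in_itv/= andbT => s0.
by apply: cvgM; [exact: cvg_cst|apply: cvgV; [rewrite gt_eqF|exact: cvg_id]].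
Qed.

Lemma integral_inversion_cc (G : R -> R) (a b : R) : 0 < a -> a <= b ->
  {in `](0 : R), +oo[, continuous G} ->
  (\int[mu]_(s in `[(a ^+ 2 / b)%R, a]) (G s)%:E =
   \int[mu]_(s in `[a, b]) (G (a ^+ 2 / s) * (a ^+ 2 / s ^+ 2))%:E)%E.
Proof.
move=> a0 ab cG; pose F (s : R) := a ^+ 2 / s.
have b0 : 0 < b by apply: lt_le_trans ab.
have Fa : F a = a by rewrite /F; field; rewrite gt_eqF.
have F'E (s : R) : 0 < s -> F^`()%classic s = - (a ^+ 2 / s ^+ 2).
  by move=> s0; rewrite /F derive1_inversion.
have cF' (s : R) : 0 < s -> F^`()%classic x @[x --> s] --> F^`()%classic s.
  move=> s0; rewrite F'E//.
  have : (- (a ^+ 2 / x ^+ 2)) @[x --> s] --> - (a ^+ 2 / s ^+ 2).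
    by apply: cvgN; apply: continuous_inversion_deriv; rewrite in_itv/= s0.
  apply: cvg_trans; apply: near_eq_cvg; near=> x.
  by rewrite F'E//; near: x; exact: lt_nbhsr.
have cF (s : R) : 0 < s -> F x @[x --> s] --> F s.
  by move=> s0; apply: continuous_inversion; rewrite in_itv/= s0.
rewrite -{2}Fa (@integration_by_substitution_decreasing R F G a b ab).
- apply: eq_integral => s; rewrite inE/= in_itv/= => /andP[sa _].
  by rewrite !fctE F'E ?opprK// (lt_le_trans a0).
- move=> x y; rewrite !in_itv/= => /andP[xa _] /andP[ya _] xy.
  by rewrite /F ltr_pM2l ?exprn_gt0// ltf_pV2// posrE; lra.
- by move=> x; rewrite in_itv/= => /andP[xa _]; apply: cF'; lra.
- by apply/cvg_ex; exists (F^`()%classic a); apply: cvg_at_right_filter; exact: cF'.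
- by apply/cvg_ex; exists (F^`()%classic b); apply: cvg_at_left_filter; exact: cF'.
- split.
  + move=> x; rewrite in_itv/= => /andP[xa _].
    by have [] := is_derive_inversion (a ^+ 2) (lt_trans a0 xa).
  + by apply: cvg_at_right_filter; exact: cF.
  + by apply: cvg_at_left_filter; exact: cF.
- apply: continuous_in_subspaceT => x; rewrite inE/= in_itv/= => /andP[xa _].
  by apply: cG; rewrite in_itv/= andbT; apply: lt_le_trans xa; rewrite divr_gt0// exprn_gt0.
Unshelve. all: by end_near. Qed.

(** The change of variable s -> a^2 / s exchanges ]0, a] and [a, +oo[. It is
made on the compact intervals [a, k a], and monotone convergence lets k tend to
infinity. *)
Lemma integral_inversion (G : R -> R) (a : R) : 0 < a ->
  {in `](0 : R), +oo[, continuous G} -> (forall s, 0 < s -> 0 <= G s) ->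
  (\int[mu]_(s in `](0%R : R), a]) (G s)%:E =
   \int[mu]_(s in `[a, +oo[) (G (a ^+ 2 / s) * (a ^+ 2 / s ^+ 2))%:E)%E.
Proof.
move=> a0 cG G0.
have n1 (n : nat) : 1 <= n.+1%:R :> R by rewrite ler1n.
pose A (n : nat) : set R := `[(a / n.+1%:R)%R, a]%classic.
pose B (n : nat) : set R := `[a, (a * n.+1%:R)%R]%classic.
have AB n : (\int[mu]_(s in A n) (G s)%:E =
     \int[mu]_(s in B n) (G (a ^+ 2 / s) * (a ^+ 2 / s ^+ 2))%:E)%E.
  rewrite /A /B -integral_inversion_cc//; last by rewrite ler_pMr.
  suff -> : a / n.+1%:R = a ^+ 2 / (a * n.+1%:R) by [].
  by rewrite expr2 invfM mulrACA divff ?mul1r// gt_eqF.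
have UA : \bigcup_n A n = `](0 : R), a]%classic.
  apply/seteqP; split=> [s [n _]|s]; rewrite /A /= !in_itv/= => /andP[h1 h2].
    by rewrite h2 andbT (lt_le_trans _ h1)// divr_gt0.
  exists (Num.truncn (a / s)) => //=; rewrite in_itv/= h2 andbT.
  rewrite ler_pdivrMr// mulrC -ler_pdivrMr//.
  exact/ltW/Num.Theory.truncnS_gt.
have UB : \bigcup_n B n = `[a, +oo[%classic.
  apply/seteqP; split=> [s [n _]|s]; rewrite /B /= !in_itv/=.
    by move=> /andP[->].
  rewrite andbT => h; exists (Num.truncn (s / a)) => //=; rewrite in_itv/= h/=.
  rewrite mulrC -ler_pdivrMr//.
  exact/ltW/Num.Theory.truncnS_gt.
have ndA : nondecreasing_seq A.
  move=> m n mn; apply/subsetPset => s; rewrite /A /= !in_itv/= => /andP[h1 ->].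
  rewrite andbT (le_trans _ h1)// ler_pM2l// lef_pV2 ?posrE//.
  by rewrite ler_nat ltnS.
have ndB : nondecreasing_seq B.
  move=> m n mn; apply/subsetPset => s; rewrite /B /= !in_itv/= => /andP[-> h1].
  rewrite (le_trans h1)// ler_pM2l//.
  by rewrite ler_nat ltnS.
have gA n s : A n s -> 0 < s.
  by rewrite /A /= in_itv/= => /andP[h _]; rewrite (lt_le_trans _ h)// divr_gt0.
have gB n s : B n s -> 0 < s.
  by rewrite /B /= in_itv/= => /andP[h _]; rewrite (lt_le_trans _ h).
have mG : measurable_fun `](0 : R), +oo[ G by exact: continuous_measurable_0y.
have mH : measurable_fun `](0 : R), +oo[
    (fun s => G (a ^+ 2 / s) * (a ^+ 2 / s ^+ 2)).
  apply: continuous_measurable_0y => s; rewrite in_itv/= andbT => s0.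
  apply: cvgM; last by apply: continuous_inversion_deriv; rewrite in_itv/= s0.
  apply: (@continuous_comp _ _ _ (fun s : R => a ^+ 2 / s) G).
    by apply: continuous_inversion; rewrite in_itv/= s0.
  by apply: cG; rewrite in_itv/= andbT divr_gt0// exprn_gt0.
rewrite -UA -UB.
have cA : ((\int[mu]_(s in A n) (G s)%:E) @[n --> \oo] -->
    \int[mu]_(s in \bigcup_n A n) (G s)%:E)%E.
  apply: (@ge0_nondecreasing_set_cvg_integral _ (measurableTypeR R) R A
    (fun s => (G s)%:E) mu ndA).
  - by move=> n; exact: measurable_itv.
  - move=> n; apply/measurable_EFinP; apply: measurable_funS mG => //.
    by move=> s /gA s0; rewrite /= in_itv/= s0.
  - by move=> n s /gA s0; rewrite lee_fin G0.
have cB : ((\int[mu]_(s in A n) (G s)%:E) @[n --> \oo] -->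
    \int[mu]_(s in \bigcup_n B n) (G (a ^+ 2 / s) * (a ^+ 2 / s ^+ 2))%:E)%E.
  under eq_cvg do rewrite AB.
  apply: (@ge0_nondecreasing_set_cvg_integral _ (measurableTypeR R) R B
    (fun s => (G (a ^+ 2 / s) * (a ^+ 2 / s ^+ 2))%:E) mu ndB).
  - by move=> n; exact: measurable_itv.
  - move=> n; apply/measurable_EFinP; apply: measurable_funS mH => //.
    by move=> s /gB s0; rewrite /= in_itv/= s0.
  - move=> n s /gB s0; rewrite lee_fin mulr_ge0//.
      by rewrite G0// divr_gt0// exprn_gt0.
    by rewrite divr_ge0 ?exprn_ge0// ltW.
by rewrite -(cvg_lim _ cA)// -(cvg_lim _ cB).
Qed.

(** The change of variable u = ln (s / a). It is read from s to u because the
substitution theorem wants a derivative with limits at both ends, and 1 / s has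
them whereas the derivative of the exponential has not. *)
Lemma integral_log_subst (G : R -> R) (a : R) : 0 < a ->
  continuous G -> (forall u, 0 <= G u) ->
  (\int[mu]_(u in `[0%R, +oo[) (G u)%:E =
   \int[mu]_(s in `[a, +oo[) (G (ln (s / a)) / s)%:E)%E.
Proof.
move=> a0 cG G0; pose F (s : R) := ln (s / a).
have Fa : F a = 0 by rewrite /F divff ?ln1// gt_eqF.
have dF (s : R) : 0 < s -> is_derive s 1 F s^-1.
  move=> s0; have sa : 0 < s / a by rewrite divr_gt0.
  have d1 := is_derive1_ln sa.
  have d2 : is_derive s 1 (fun x : R => x / a) a^-1.
    by apply: is_derive_eq; rewrite /GRing.scale/=; ring.
  have := @is_derive1_comp R (@ln R) (fun x : R => x / a) s _ _ d1 d2.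
  by move=> h; apply: (is_derive_eq h); field; rewrite !gt_eqF.
have F'E (s : R) : 0 < s -> F^`()%classic s = s^-1.
  by move=> s0; rewrite derive1E; have [_ ->] := dF s s0.
have cF' (s : R) : 0 < s -> F^`()%classic x @[x --> s] --> F^`()%classic s.
  move=> s0; rewrite F'E//.
  have : x^-1 @[x --> s] --> s^-1 by apply: cvgV; [rewrite gt_eqF|exact: cvg_id].
  apply: cvg_trans; apply: near_eq_cvg; near=> x.
  by rewrite F'E//; near: x; exact: lt_nbhsr.
have cF (s : R) : 0 < s -> F x @[x --> s] --> F s.
  move=> s0; apply: differentiable_continuous; apply/derivable1_diffP.
  by have [] := dF s s0.
rewrite -Fa (@increasing_ge0_integration_by_substitutiony R F G a).
- apply: eq_integral => s; rewrite inE/= in_itv/= andbT => sa.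
  by rewrite !fctE F'E// (lt_le_trans a0).
- move=> x y; rewrite !in_itv/= !andbT => xa ya xy.
  have x0 := lt_le_trans a0 xa; have y0 := lt_le_trans a0 ya.
  by rewrite /F ltr_ln ?posrE ?divr_gt0// ltr_pM2r// invr_gt0.
- by move=> x; rewrite in_itv/= andbT => xa; apply: cF'; lra.
- by apply/cvg_ex; exists (F^`()%classic a); apply: cvg_at_right_filter; exact: cF'.
- apply/cvg_ex; exists 0.
  have : (fun x : R => x^-1) x @[x --> +oo%R] --> (0 : R).
    apply/gtr0_cvgV0; last exact: cvg_id.
    exact: nbhs_pinfty_gt.
  apply: cvg_trans; apply: near_eq_cvg; near=> x.
  by rewrite F'E//; near: x; exact: nbhs_pinfty_gt.
- split.
  + move=> x; rewrite in_itv/= andbT => xa.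
    by have [] := dF x (lt_trans a0 xa).
  + by apply: cvg_at_right_filter; exact: cF.
- apply/cvgryPge => M; near=> x; rewrite /F -ler_expR lnK; last first.
    by rewrite posrE divr_gt0//; near: x; exact: nbhs_pinfty_gt.
  by rewrite ler_pdivlMr//; near: x; exact: nbhs_pinfty_ge.
- exact: continuous_subspaceT.
- by move=> x _; exact: G0.
Unshelve. all: by end_near. Qed.

Lemma continuous_coshR (z : R) :
  continuous (fun u : R => expR (- z * coshR u) * coshR (1 * u)).
Proof.
have cc : continuous (@coshR R).
  move=> u; apply: cvgM; last exact: cvg_cst.
  apply: cvgD; first exact: continuous_expR.
  by apply: continuous_comp; [exact: cvgN|exact: continuous_expR].
move=> u; apply: cvgM.
  apply: continuous_comp; last exact: continuous_expR.
  by apply: cvgM; [exact: cvg_cst|exact: cc].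
apply: continuous_comp; last exact: cc.
by apply: cvgM; [exact: cvg_cst|exact: cvg_id].
Qed.

Lemma coshR_ln (x : R) : 0 < x -> coshR (ln x) = (x + x^-1) / 2.
Proof. by move=> x0; rewrite /coshR expRN lnK. Qed.

(** When e a^2 = q, the integrand of mixint q e is invariant under s -> a^2 / s,
so the part of the integral on ]0, a] can be brought back to [a, +oo[. *)
Lemma mixint_fold (q e a : R) : 0 <= q -> 0 < e -> 0 < a -> e * a ^+ 2 = q ->
  (mixint q e)%:E = (\int[mu]_(s in `[a, +oo[)
      (mixker q e s * (1 + a ^+ 2 / s ^+ 2))%:E)%E.
Proof.
move=> q0 e0 a0 qE.
have iK := integrable_mixker q0 e0.
rewrite /mixint /Rintegral fineK; last exact: integrable_fin_num.
have UI : `](0 : R), +oo[%classic = `](0 : R), a] `|` `]a, +oo[.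
  apply/seteqP; split=> s /=; rewrite !in_itv/= !andbT.
    by move=> s0; case: (leP s a) => sa; [left; rewrite s0|right].
  by case=> [/andP[]//|]; apply: lt_trans.
have mK : measurable_fun `](0 : R), +oo[ (mixker q e).
  by apply: continuous_measurable_0y; exact: continuous_mixker.
have K0 s : 0 < s -> 0 <= mixker q e s by move=> _; exact: mixker_ge0.
have sub1 : `]a, +oo[ `<=` `](0 : R), +oo[.
  by move=> s /=; rewrite !in_itv/= !andbT; apply: lt_trans.
have sub2 : `[a, +oo[ `<=` `](0 : R), +oo[.
  by move=> s /=; rewrite !in_itv/= !andbT; apply: lt_le_trans.
rewrite UI ge0_integral_setU//=; last 3 first.
- by rewrite -UI; apply/measurable_EFinP.
- by move=> x _; rewrite lee_fin mixker_ge0.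
- rewrite disj_set2E; apply/eqP; rewrite -subset0 => s /= [].
  by rewrite !in_itv/= andbT => /andP[_ h1] h2; lra.
rewrite (integral_inversion a0 (@continuous_mixker _ q e) K0).
have -> : (\int[mu]_(s in `[a, +oo[)
      (mixker q e (a ^+ 2 / s) * (a ^+ 2 / s ^+ 2))%:E =
    \int[mu]_(s in `[a, +oo[) (mixker q e s * (a ^+ 2 / s ^+ 2))%:E)%E.
  apply: eq_integral => s; rewrite inE/= in_itv/= andbT => sa; have s0 := lt_le_trans a0 sa.
  congr (_ * _)%:E; rewrite /mixker; congr (expR (- _)).
  by rewrite -qE; field; rewrite !gt_eqF.
rewrite integral_itv_obnd_cbnd; last first.
  by apply/measurable_EFinP; exact: measurable_funS mK.
have mK2 : measurable_fun `[a, +oo[ (fun s => a ^+ 2 / s ^+ 2).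
  apply: (measurable_funS _ sub2) => //.
  by apply: continuous_measurable_0y; exact: continuous_inversion_deriv.
have mK1 : measurable_fun `[a, +oo[ (mixker q e) by exact: measurable_funS mK.
rewrite -ge0_integralD//=; last 4 first.
- move=> s; rewrite in_itv/= andbT => sa; rewrite lee_fin mulr_ge0 ?mixker_ge0//.
  by rewrite divr_ge0// sqr_ge0.
- by apply/measurable_EFinP; exact: measurable_funM.
- by move=> s _; rewrite lee_fin mixker_ge0.
- exact/measurable_EFinP.
apply: eq_integral => s _; rewrite -EFinD; congr EFin.
by rewrite mulrDr mulr1 addrC.
Qed.

(** With u = ln (s / (d t)), the exponent - z cosh u is - (e s + d^2 / s), and
the factor cosh u ds / s becomes (1 + a^2 / s^2) ds / (2 a) with a = d t, which
mixint_fold recognizes. *)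
Lemma besselK1E (d t : R) : 0 < d -> 0 < t ->
  besselK 1 (2 * (d / t)) = mixint (d ^+ 2) (t ^+ 2)^-1 / (2 * (d * t)).
Proof.
move=> d0 t0; set z := 2 * (d / t); set e := (t ^+ 2)^-1.
have a0 : 0 < d * t by rewrite mulr_gt0.
have e0 : 0 < e by rewrite invr_gt0 exprn_gt0.
have q0 : 0 <= d ^+ 2 by rewrite sqr_ge0.
have qE : e * (d * t) ^+ 2 = d ^+ 2 by rewrite /e; field; rewrite gt_eqF.
have cosh0 (u : R) : 0 <= coshR u.
  by rewrite /coshR divr_ge0// addr_ge0 ?expR_ge0.
have G0 (u : R) : 0 <= expR (- z * coshR u) * coshR (1 * u).
  by rewrite mulr_ge0 ?expR_ge0.
rewrite /besselK /Rintegral (integral_log_subst a0 (@continuous_coshR z) G0).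
have -> : (\int[mu]_(s in `[(d * t)%R, +oo[) (expR (- z * coshR (ln (s / (d * t))))
        * coshR (1 * ln (s / (d * t))) / s)%:E =
    \int[mu]_(s in `[(d * t)%R, +oo[) (((2 * (d * t))^-1)%:E *
   (mixker (d ^+ 2) e s * (1 + (d * t) ^+ 2 / s ^+ 2))%:E))%E.
  apply: eq_integral => s; rewrite inE/= in_itv/= andbT => sa; have s0 := lt_le_trans a0 sa.
  rewrite -EFinM; congr EFin; rewrite mul1r coshR_ln ?divr_gt0// /mixker.
  have -> : - z * ((s / (d * t) + (s / (d * t))^-1) / 2) = - (e * s + d ^+ 2 / s).
    by rewrite /z /e; field; rewrite !gt_eqF.
  by move: (expR _) => k; field; rewrite !gt_eqF.
have m0 := (@continuous_measurable_0y R _ (@continuous_mixker _ (d ^+ 2) e)).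
rewrite ge0_integralZl_EFin//=.
- by rewrite -(mixint_fold q0 e0 a0 qE)/= mulrC.
- move=> s; rewrite in_itv/= andbT => sa; rewrite lee_fin.
  by rewrite mulr_ge0 ?mixker_ge0// addr_ge0// divr_ge0// sqr_ge0.
- apply/measurable_EFinP; apply: (@measurable_funS _ _ _ _ `](0 : R), +oo[) => //.
    by move=> s /=; rewrite !in_itv/= !andbT; apply: lt_le_trans.
  apply: measurable_funM => //; apply: measurable_funD => //.
  by apply: continuous_measurable_0y; exact: continuous_inversion_deriv.
- by rewrite invr_ge0 mulr_ge0// ltW.
Qed.

Lemma gammaR1 : gammaR 1 = 1 :> R.
Proof.
rewrite /gammaR /Rintegral.
under eq_integral do rewrite subrr powRr0 mul1r -[X in - X]mul1r.
by rewrite integral_exp//= invr1.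
Qed.

Lemma matern1E (d t : R) : 0 <= d -> 0 < t ->
  matern 1 (d / t) = (t ^+ 2)^-1 * mixint (d ^+ 2) (t ^+ 2)^-1.
Proof.
move=> d0 t0; have e0 : 0 < (t ^+ 2)^-1 by rewrite invr_gt0 exprn_gt0.
move: d0; rewrite le_eqVlt => /predU1P[<-|d0].
  by rewrite /matern mul0r eqxx expr0n/= mixint0// divff// gt_eqF.
have z0 : 0 < d / t by rewrite divr_gt0.
rewrite /matern gt_eqF// gammaR1 subrr powRr0 invr1 !mul1r sqrtr1 mulr1.
rewrite powRr1; last by rewrite mulr_ge0// ltW.
rewrite besselK1E//; move: (mixint _ _) => m.
by field; rewrite !gt_eqF.
Qed.

End MaternMixture.

(** * Coercivity of the mixture matrix *)

Section Coercivity.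
Variables (R : realType) (r n : nat) (x : 'I_n -> 'cV[R]_r).
Notation mu := (@lebesgue_measure R).

Local Notation sqd i j := (enorm (x i - x j) ^+ 2).

Lemma enorm_sqr (v : 'cV[R]_r) : enorm v ^+ 2 = \sum_(l < r) v l 0 ^+ 2.
Proof. by rewrite /enorm sqr_sqrtr// sumr_ge0// => l _; rewrite sqr_ge0. Qed.

Let dot i j : R := \sum_(l < r) x i l 0 * x j l 0.

Lemma sqd_dot i j : sqd i j = dot i i + dot j j - 2 * dot i j.
Proof.
rewrite enorm_sqr /dot mulr_sumr -big_split/= -sumrB.
by apply: eq_bigr => l _; rewrite !mxE; ring.
Qed.

(** Induction on k: one factor of the inner product splits as a sum over
coordinates, and each term is the same form at the vector a multiplied by that
coordinate. *)
Lemma dot_pow_psd k (a : 'I_n -> R) :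
  0 <= \sum_i \sum_j a i * a j * dot i j ^+ k.
Proof.
elim: k a => [|k IHk] a.
  under eq_bigr do under eq_bigr do rewrite expr0 mulr1.
  under eq_bigr do rewrite -mulr_sumr.
  by rewrite -mulr_suml -expr2 sqr_ge0.
rewrite (_ : \sum_i _ = \sum_(l < r) \sum_i \sum_j
    (a i * x i l 0) * (a j * x j l 0) * dot i j ^+ k).
  by apply: sumr_ge0 => l _; exact: IHk.
rewrite [RHS]exchange_big/=; apply: eq_bigr => i _.
rewrite [RHS]exchange_big/=; apply: eq_bigr => j _.
rewrite exprS {1}/dot mulr_suml mulr_sumr; apply: eq_bigr => l _.
by ring.
Qed.

(** The exponential series has nonnegative coefficients. *)
Lemma exp_dot_psd (c : R) (a : 'I_n -> R) : 0 <= c ->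
  0 <= \sum_i \sum_j a i * a j * expR (c * dot i j).
Proof.
move=> c0.
pose S (N : nat) := \sum_i \sum_j a i * a j * series (exp_coeff (c * dot i j)) N.
have cS : S N @[N --> \oo] --> \sum_i \sum_j a i * a j * expR (c * dot i j).
  apply: cvg_big => [|i _]; first exact: add_continuous.
  apply: cvg_big => [|j _]; first exact: add_continuous.
  by apply: cvgM; [exact: cvg_cst|exact: is_cvg_series_exp_coeff].
rewrite -(cvg_lim _ cS)//; apply: limr_ge; first exact: cvgP cS.
apply: nearW => N; rewrite /S.
rewrite (_ : \sum_i _ = \sum_(0 <= k < N) c ^+ k / k`!%:R *
   \sum_i \sum_j a i * a j * dot i j ^+ k).
  apply: sumr_ge0 => k _; rewrite mulr_ge0 ?dot_pow_psd//.
  by rewrite divr_ge0// exprn_ge0.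
under [RHS]eq_bigr do rewrite mulr_sumr.
rewrite [RHS]exchange_big/=; apply: eq_bigr => i _.
under [RHS]eq_bigr do rewrite mulr_sumr.
rewrite [RHS]exchange_big/=; apply: eq_bigr => j _.
rewrite /series/= mulr_sumr; apply: eq_bigr => k _.
by rewrite /exp_coeff/= exprMn; ring.
Qed.

(** exp (- c |x_i - x_j|^2) is exp (2 c <x_i, x_j>) up to a factor depending on
i and a factor depending on j. *)
Lemma gauss_psd (c : R) (a : 'I_n -> R) : 0 <= c ->
  0 <= \sum_i \sum_j a i * a j * expR (- (c * sqd i j)).
Proof.
move=> c0.
rewrite (_ : \sum_i _ = \sum_i \sum_j (a i * expR (- (c * dot i i))) *
   (a j * expR (- (c * dot j j))) * expR (2 * c * dot i j)).
  by apply: exp_dot_psd; rewrite mulr_ge0.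
apply: eq_bigr => i _; apply: eq_bigr => j _.
have -> : - (c * sqd i j) = - (c * dot i i) + - (c * dot j j) + 2 * c * dot i j.
  by rewrite sqd_dot; ring.
by rewrite !expRD; ring.
Qed.

(** An upper bound of the inverse squared distances between distinct points; the
diagonal terms contribute 0^-1 = 0. *)
Let S := 1 + \sum_i \sum_j (sqd i j)^-1.

Let S_gt0 : 0 < S.
Proof.
rewrite /S ltr_pwDl//; apply: sumr_ge0 => i _; apply: sumr_ge0 => j _.
by rewrite invr_ge0 sqr_ge0.
Qed.

Let sqdV_le i j : (sqd i j)^-1 <= S.
Proof.
rewrite /S (bigD1 i)//= (bigD1 j)//= addrCA -addrA lerDl.
rewrite !addr_ge0//; apply: sumr_ge0 => k _.
  by rewrite invr_ge0 sqr_ge0.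
by apply: sumr_ge0 => l _; rewrite invr_ge0 sqr_ge0.
Qed.

Lemma sqd_gt0 i j : injective x -> i != j -> 0 < sqd i j.
Proof.
move=> xI ij; rewrite exprn_gt0// lt_neqAle sqrtr_ge0 andbT eq_sym.
apply: contra ij => /eqP e0; apply/eqP/xI/eqP; rewrite -subr_eq0.
have : sqd i j = 0 by rewrite e0 expr0n.
rewrite enorm_sqr => /eqP; rewrite psumr_eq0; last by move=> l _; rewrite sqr_ge0.
move=> /allP h; apply/eqP/colP => l; rewrite [RHS]mxE; apply/eqP.
by rewrite -sqrf_eq0; apply: h; rewrite mem_index_enum.
Qed.

(** For i != j the entry is at most s / |x_i - x_j|^2 <= 1 / (2 n); the
off-diagonal part of the form is then at most half of the squared norm of a. *)
Lemma gauss_coercive (a : 'I_n -> R) (s : R) : injective x -> (0 < n)%N ->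
  0 < s <= (2 * n%:R * S)^-1 ->
  (\sum_i a i ^+ 2) / 2 <= \sum_i \sum_j a i * a j * expR (- (sqd i j / s)).
Proof.
move=> xI n0 /andP[s0 sS].
have nR : 0 < n%:R :> R by rewrite ltr0n.
apply: (@le_trans _ _ (\sum_i \sum_j ((i == j)%:R * a i ^+ 2
    - (a i ^+ 2 + a j ^+ 2) / (4 * n%:R)))).
  rewrite le_eqVlt; apply/orP; left; apply/eqP.
  rewrite [RHS](_ : _ = \sum_i (a i ^+ 2 / 2 - (\sum_j a j ^+ 2) / (4 * n%:R)
     + a i ^+ 2 / 4)); last first.
    apply: eq_bigr => i _; rewrite sumrB (bigD1 i)//= eqxx mul1r big1 ?addr0.
      rewrite -mulr_suml big_split/= sumr_const card_ord -mulr_natl.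
      by field; rewrite gt_eqF.
    by move=> j ji; rewrite eq_sym (negbTE ji) mul0r.
  rewrite big_split/= sumrB -!mulr_suml sumr_const card_ord -mulr_natl.
  by field; rewrite gt_eqF.
apply: ler_sum => i _; apply: ler_sum => j _.
have [<-|ij] := eqVneq i j.
  have -> : sqd i i = 0 by rewrite subrr enorm_sqr big1// => l _; rewrite mxE expr0n.
  rewrite mul0r oppr0 expR0 mul1r mulr1 -expr2 gerBl.
  by rewrite divr_ge0 ?addr_ge0 ?sqr_ge0// mulr_ge0// ltW.
rewrite mul0r add0r; have q0 := sqd_gt0 xI ij.
have E1 : expR (- (sqd i j / s)) <= (2 * n%:R)^-1.
  rewrite expRN; apply: (@le_trans _ _ (s / sqd i j)).
    rewrite -[leRHS]invf_div lef_pV2 ?posrE ?expR_gt0 ?divr_gt0//.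
    by apply: le_trans (expR_ge1Dx _); rewrite lerDr.
  apply: (@le_trans _ _ (s * S)); first by rewrite ler_pM2l.
  by rewrite -ler_pdivlMr// -invfM.
have E0 := expR_ge0 (- (sqd i j / s)).
set E := expR _ in E0 E1 *.
have h1 : - ((a i ^+ 2 + a j ^+ 2) / 2) <= a i * a j.
  by have := sqr_ge0 (a i + a j); rewrite sqrrD; lra.
have h2 : 0 <= a i ^+ 2 + a j ^+ 2 by rewrite addr_ge0 ?sqr_ge0.
apply: (@le_trans _ _ (- ((a i ^+ 2 + a j ^+ 2) / 2) * E)); last first.
  by rewrite ler_wpM2r.
rewrite mulNr lerN2.
apply: (@le_trans _ _ ((a i ^+ 2 + a j ^+ 2) / 2 * (2 * n%:R)^-1)).
  by rewrite ler_wpM2l// divr_ge0.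
rewrite le_eqVlt; apply/orP; left; apply/eqP.
by field; rewrite gt_eqF.
Qed.

Definition mixmx (e : R) : 'M[R]_n := \matrix_(i, j) mixint (sqd i j) e.

Lemma qform_mixmx e (a : 'cV[R]_n) : 0 < e ->
  qform (mixmx e) a = Rintegral mu `](0 : R), +oo[ (fun s => expR (- (e * s)) *
      \sum_i \sum_j a i 0 * a j 0 * expR (- (sqd i j / s)))
  /\ mu.-integrable `](0 : R), +oo[ (EFin \o (fun s => expR (- (e * s)) *
      \sum_i \sum_j a i 0 * a j 0 * expR (- (sqd i j / s)))).
Proof.
move=> e0; rewrite qformE.
have -> : (fun s : R => expR (- (e * s)) *
      \sum_i \sum_j a i 0 * a j 0 * expR (- (sqd i j / s))) =
   (fun s => \sum_i \sum_j a i 0 * a j 0 * mixker (sqd i j) e s).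
  apply/funext => s; rewrite mulr_sumr; apply: eq_bigr => i _.
  rewrite mulr_sumr; apply: eq_bigr => j _.
  by rewrite /mixker opprD expRD; ring.
have Iij i j := integrable_mixker (sqr_ge0 (enorm (x i - x j))) e0.
have m0y : (R.-ocitv.-measurable).-sigma.-measurable
  (`](0 : R), +oo[%classic : set R) by [].
have Iai i j := integrableRZ (a i 0 * a j 0) m0y (Iij i j).
have Ii i := integrableR_sum (index_enum 'I_n) m0y (Iai i).
split; last exact: (integrableR_sum (index_enum 'I_n) m0y Ii).
rewrite (Rintegral_sum (index_enum 'I_n) m0y Ii); apply: eq_bigr => i _.
rewrite (Rintegral_sum (index_enum 'I_n) m0y (Iai i)); apply: eq_bigr => j _.
by rewrite RintegralZl// mxE.
Qed.

(** Only the interval ]0, s0] is kept, on which gauss_coercive applies; the rest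
of the integral is nonnegative by gauss_psd. *)
Lemma mixmx_coercive : injective x -> (0 < n)%N ->
  exists2 c : R, 0 < c & forall e, 0 < e <= 1 -> coercive (mixmx e) c.
Proof.
move=> xI n0; have nR : 0 < n%:R :> R by rewrite ltr0n.
pose s0 := (2 * n%:R * S)^-1.
have s00 : 0 < s0 by rewrite invr_gt0 !mulr_gt0.
exists (expR (- s0) / 2 * s0); first by rewrite mulr_gt0// divr_gt0// expR_gt0.
move=> e /andP[e0 e1] a; have [-> iH] := qform_mixmx a e0.
pose H (s : R) := expR (- (e * s)) *
  \sum_i \sum_j a i 0 * a j 0 * expR (- (sqd i j / s)).
rewrite -/H in iH *.
have H0 (s : R) : 0 < s -> 0 <= H s.
  move=> s_gt0; rewrite /H mulr_ge0 ?expR_ge0//.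
  under eq_bigr do under eq_bigr do rewrite [_ / s]mulrC.
  by apply: gauss_psd; rewrite invr_ge0 ltW.
have H1 (s : R) : 0 < s <= s0 -> expR (- s0) / 2 * sqnorm a <= H s.
  move=> ss; have /andP[s_gt0 ss0] := ss; rewrite sqnormE -mulrA.
  apply: ler_pM; rewrite ?expR_ge0//.
  - by rewrite mulr_ge0// sumr_ge0// => i _; rewrite sqr_ge0.
  - rewrite ler_expR lerN2; apply: le_trans ss0.
    by rewrite -[leRHS]mul1r ler_pM2r.
  - by rewrite mulrC; exact: (@gauss_coercive (fun i => a i 0)).
have /integrableP[mH _] := iH.
rewrite -lee_fin /Rintegral fineK; last exact: integrable_fin_num.
have -> : ((expR (- s0) / 2 * s0 * sqnorm a)%:E =
   \int[mu]_(s in `](0%R : R), s0]) (expR (- s0) / 2 * sqnorm a)%:E)%E.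
  rewrite integral_cst//= lebesgue_measure_itv/= lte_fin s00 oppr0 adde0 -EFinM.
  by congr EFin; ring.
have sub : `](0 : R), s0] `<=` `](0 : R), +oo[.
  by move=> s /=; rewrite !in_itv/= andbT => /andP[].
apply: (@le_trans _ _ (\int[mu]_(s in `](0%R : R), s0]) (H s)%:E)%E).
  apply: ge0_le_integral => //=.
  - by move=> s _; rewrite lee_fin !mulr_ge0 ?sqnorm_ge0 ?expR_ge0.
  - exact: measurable_funS mH.
apply: ge0_subset_integral => //= s; rewrite in_itv/= andbT lee_fin; exact: H0.
Qed.

End Coercivity.

(** * Contrasts *)

Section Contrasts.
Variables (R : realType) (m : nat) (W : 'M[R]_(m.+1, m)).
Hypothesis WW : W^T *m W = 1%:M.
Hypothesis W1 : (const_mx 1 : 'rV[R]_m.+1) *m W = 0.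

Let n1 : R := m.+1%:R.
Let k : R := (Num.sqrt n1)^-1.
Let U : 'M[R]_(m.+1, 1 + m) := row_mx (k *: const_mx 1) W.

Let n1_gt0 : 0 < n1. Proof. by rewrite ltr0n. Qed.

Let kk : k * k = n1^-1.
Proof. by rewrite /k -invfM -expr2 sqr_sqrtr// ltW. Qed.

Let one_mx : (const_mx 1 : 'rV[R]_m.+1) *m (const_mx 1 : 'cV[R]_m.+1) = n1%:M.
Proof.
rewrite [LHS]mx11_scalar mxE; congr _%:M.
under eq_bigr do rewrite !mxE mulr1.
by rewrite sumr_const card_ord.
Qed.

Let UT : U^T = col_mx (k *: const_mx 1) W^T.
Proof. by rewrite tr_row_mx linearZ/= trmx_const. Qed.

Let WT1 : W^T *m (const_mx 1 : 'cV[R]_m.+1) = 0.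
Proof. by apply: trmx_inj; rewrite trmx_mul trmxK trmx_const W1 trmx0. Qed.

Let UTU : U^T *m U = 1%:M.
Proof.
rewrite UT mul_col_row -!scalemxAl -!scalemxAr WT1 W1 WW !scaler0.
by rewrite one_mx scalerA kk scale_scalar_mx mulVf ?gt_eqF// -scalar_mx_block.
Qed.

Lemma contrast_ones : W^T *m (const_mx 1 : 'cV[R]_m.+1) = 0.
Proof. exact: WT1. Qed.

(** The columns of W, completed by the normalized vector of ones, form an
orthogonal matrix. *)
Lemma contrast_complete : W *m W^T = 1%:M - n1^-1 *: const_mx 1.
Proof.
have := mulmx1C UTU; rewrite UT mul_row_col -scalemxAl -scalemxAr scalerA kk.
rewrite (_ : _ *m _ = const_mx 1); last first.
  apply/matrixP => i j; rewrite !mxE (eq_bigr (fun=> 1)) => [|l _].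
    by rewrite sumr_const card_ord.
  by rewrite !mxE mulr1.
by move=> <-; rewrite [X in X - _]addrC addrK.
Qed.

Lemma sqnorm_contrast (w : 'cV[R]_m) : sqnorm (W *m w) = sqnorm w.
Proof. by rewrite /sqnorm trmx_mul mulmxA -(mulmxA w^T) WW mulmx1. Qed.

Lemma qform_contrast (A : 'M[R]_m.+1) (w : 'cV[R]_m) :
  qform (W^T *m A *m W) w = qform A (W *m w).
Proof. exact: qformM. Qed.

Lemma sum_contrast (w : 'cV[R]_m) : \sum_i (W *m w) i 0 = 0.
Proof.
have : (const_mx 1 : 'rV[R]_m.+1) *m (W *m w) = 0 by rewrite mulmxA W1 mul0mx.
move=> /matrixP/(_ 0 0); rewrite mxE [RHS]mxE => h; rewrite -[RHS]h.
by apply: eq_bigr => i _; rewrite [const_mx _ _ _]mxE mul1r.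
Qed.

(** In the orthonormal basis given by the normalized vector of ones and the
columns of W, the corner entry of the inverse of A is the minor of index (0, 0)
divided by the determinant: the first is the form of A^-1 at the vector of ones,
up to the factor 1 / n, and the minor is det (W^T A W). *)
Lemma det_contrast (A : 'M[R]_m.+1) : A \in unitmx ->
  \det A * qform (invmx A) (const_mx 1) = n1 * \det (W^T *m A *m W).
Proof.
move=> uA; pose M : 'M[R]_(1 + m) := U^T *m A *m U.
have detU : \det U^T * \det U = 1 by rewrite -det_mulmx UTU det1.
have detM : \det M = \det A.
  by rewrite /M !det_mulmx mulrAC detU mul1r.
have uM : M \in unitmx by rewrite unitmxE detM -unitmxE.
have MiE : invmx M = U^T *m invmx A *m U.
  rewrite -[RHS](mulKmx uM) -[LHS]mulmx1; congr (_ *m _); rewrite /M.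
  rewrite -!mulmxA (mulmxA U) (mulmx1C UTU) mul1mx (mulmxA A) mulmxV//.
  by rewrite mul1mx UTU.
have /matrixP/(_ 0 0) := MiE.
rewrite {1}/invmx uM detM [LHS]mxE [\adj M 0 0]mxE /cofactor expr0 mul1r.
have -> : row' 0 (col' 0 M) = W^T *m A *m W.
  have -> : M = block_mx (k *: const_mx 1 *m A *m (k *: const_mx 1))
      (k *: const_mx 1 *m A *m W) (W^T *m A *m (k *: const_mx 1))
      (W^T *m A *m W).
    by rewrite /M UT mul_col_mx mul_col_row.
  apply/matrixP => i j; rewrite 2!mxE.
  have -> : lift 0 i = rshift 1 i by exact/val_inj.
  have -> : lift 0 j = rshift 1 j by exact/val_inj.
  exact: (@block_mxEdr R 1 m 1 m).
have -> : (U^T *m invmx A *m U) 0 0 = n1^-1 * qform (invmx A) (const_mx 1).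
  rewrite UT mul_col_mx mul_col_row.
  have -> : (0 : 'I_(1 + m)) = lshift m 0 by exact/val_inj.
  rewrite block_mxEul -!scalemxAl -scalemxAr scalerA kk mxE /qform trmx_const.
  by [].
move=> h; have d0 : \det A != 0 by rewrite -unitfE -unitmxE.
apply: (mulfI (invr_neq0 (lt0r_neq0 n1_gt0))).
by rewrite mulrCA -h mulrA mulfV// mul1r mulrA mulVf ?mul1r// gt_eqF.
Qed.

End Contrasts.

(** * Quadratic forms on contrasts and the trend matrix *)

Section SumZero.
Variables (R : rcfType) (n : nat).

Lemma qform_const_sum0 (u : R) (a : 'cV[R]_n) : \sum_i a i 0 = 0 ->
  qform (const_mx u) a = 0.
Proof.
move=> a0; rewrite qformE; under eq_bigr do under eq_bigr do rewrite mxE mulrAC.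
by under eq_bigr do rewrite -mulr_sumr a0 mulr0; rewrite big1.
Qed.

Lemma qformD (A B : 'M[R]_n) a : qform (A + B) a = qform A a + qform B a.
Proof. by rewrite /qform mulmxDr mulmxDl mxE. Qed.

Lemma qformZ (k : R) (A : 'M[R]_n) a : qform (k *: A) a = k * qform A a.
Proof. by rewrite /qform -scalemxAr -scalemxAl mxE. Qed.

Lemma qform_entry_le (A : 'M[R]_n) (K : R) a :
  (forall i j, `|A i j| <= K) -> `|qform A a| <= K * n%:R * sqnorm a.
Proof.
move=> AK; rewrite qformE; apply: le_trans (ler_norm_sum _ _ _) _.
apply: (@le_trans _ _ (\sum_i \sum_j K * ((a i 0 ^+ 2 + a j 0 ^+ 2) / 2))).
  apply: ler_sum => i _; apply: le_trans (ler_norm_sum _ _ _) _.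
  apply: ler_sum => j _; rewrite normrM mulrC; apply: ler_pM => //.
  rewrite ler_norml.
  have := sqr_ge0 (a i 0 - a j 0); have := sqr_ge0 (a i 0 + a j 0).
  by rewrite sqrrD sqrrB => h1 h2; apply/andP; split; lra.
rewrite sqnormE le_eqVlt; apply/orP; left; apply/eqP.
pose T := \sum_i a i 0 ^+ 2; rewrite -/T.
rewrite [LHS](eq_bigr (fun i => K / 2 * (n%:R * a i 0 ^+ 2 + T))).
  rewrite -mulr_sumr big_split/= -mulr_sumr sumr_const card_ord.
  rewrite -(mulr_natl _ n) -/T.
  by field.
move=> i _; rewrite -mulr_sumr -mulr_suml big_split/= sumr_const card_ord.
by rewrite -(mulr_natl _ n) -/T; field.
Qed.

Lemma qformN (A : 'M[R]_n) a : qform (- A) a = - qform A a.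
Proof. by rewrite -scaleN1r qformZ mulN1r. Qed.

(** On vectors of zero sum a constant matrix contributes nothing. *)
Lemma qform_approx (A V : 'M[R]_n) (u K : R) (a : 'cV[R]_n) :
  \sum_i a i 0 = 0 -> (forall i j, `|A i j - u - V i j| <= K) ->
  `|qform A a - qform V a| <= K * n%:R * sqnorm a.
Proof.
move=> a0 AK.
have -> : qform A a - qform V a = qform (A - const_mx u - V) a.
  by rewrite !qformD !qformN qform_const_sum0// subr0.
by apply: qform_entry_le => i j; rewrite !mxE; exact: AK.
Qed.

End SumZero.

Section Estimates.
Variables (R : realType) (r m : nat) (x : 'I_m.+1 -> 'cV[R]_r).
Variable W : 'M[R]_(m.+1, m).
Hypothesis WW : W^T *m W = 1%:M.
Hypothesis W1 : (const_mx 1 : 'rV[R]_m.+1) *m W = 0.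

Definition pointmx : 'M[R]_(r, m.+1) := \matrix_(l, i) x i l 0.

(** |x_i - x_j|^2 = |x_i|^2 + |x_j|^2 - 2 <x_i, x_j>, and the first two terms
vanish on contrasts. *)
Lemma contrast_sqdist :
  W^T *m sqdist_mx x *m W = (- 2) *: ((pointmx *m W)^T *m (pointmx *m W)).
Proof.
pose s : 'cV[R]_m.+1 := \col_i \sum_l x i l 0 ^+ 2.
have -> : sqdist_mx x = s *m const_mx 1 + const_mx 1 *m s^T
     + (- 2) *: (pointmx^T *m pointmx).
  apply/matrixP => i j; rewrite !mxE !big_ord1 !mxE enorm_sqr mulr1 mul1r.
  rewrite mulr_sumr -!big_split/=; apply: eq_bigr => l _; rewrite !mxE; ring.
rewrite !mulmxDr !mulmxDl.
rewrite -(mulmxA W^T) -(mulmxA s) W1 !mulmx0 add0r.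
rewrite mulmxA (contrast_ones W1) !mul0mx add0r.
by rewrite -scalemxAr -scalemxAl trmx_mul !mulmxA.
Qed.

(** The coefficient of the leading term 2 ln t of the rescaled correlation
matrix on contrasts. *)
Definition trendmx : 'M[R]_m := - (W^T *m sqdist_mx x *m W).

Lemma trendmxE : trendmx = 2 *: ((pointmx *m W)^T *m (pointmx *m W)).
Proof. by rewrite /trendmx contrast_sqdist scaleNr opprK. Qed.

Lemma trendmx_ge0 w : 0 <= qform trendmx w.
Proof.
rewrite trendmxE qformZ mulr_ge0// -[X in X *m _]mulmx1 qformM.
by rewrite /qform mulmx1; exact: sqnorm_ge0.
Qed.

Lemma qform_sqdist (w : 'cV[R]_m) :
  qform (sqdist_mx x) (W *m w) = - qform trendmx w.
Proof.
by rewrite /trendmx -(qform_contrast W) qformN opprK.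
Qed.

(** Otherwise pointmx *m W = 0, so that the coordinates of the points are
constant vectors, and all the points coincide. *)
Lemma trendmx_diag : injective x -> (0 < m)%N -> exists i, 0 < trendmx i i.
Proof.
move=> xI m0.
have tE i : trendmx i i = 2 * \sum_l ((pointmx *m W) l i) ^+ 2.
  rewrite trendmxE mxE mxE; congr (_ * _); apply: eq_bigr => l _.
  by rewrite mxE expr2.
apply/existsP; apply: contraT; rewrite negb_exists => /forallP h.
have XW : pointmx *m W = 0.
  apply/matrixP => l i; rewrite [RHS]mxE; apply/eqP; rewrite -sqrf_eq0.
  have := h i; rewrite tE -leNgt pmulr_rle0// => h1.
  have : \sum_l ((pointmx *m W) l i) ^+ 2 == 0.
    by rewrite eq_le h1/= sumr_ge0// => k _; rewrite sqr_ge0.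
  rewrite psumr_eq0; last by move=> k _; rewrite sqr_ge0.
  by move=> /allP; apply; rewrite mem_index_enum.
have : pointmx *m (W *m W^T) = 0 by rewrite mulmxA XW mul0mx.
rewrite (contrast_complete WW W1) mulmxBr mulmx1 -scalemxAr => /eqP.
rewrite subr_eq0 => /eqP pE.
have x01 : x ord0 = x ord_max.
  apply/colP => l; have /matrixP/(_ l) h1 := pE.
  have h2 i : x i l 0 = (m.+1%:R^-1 *: (pointmx *m const_mx 1)) l i.
    by rewrite -pE mxE.
  rewrite !h2 !mxE; congr (_ * _); apply: eq_bigr => j _; by rewrite !mxE.
by have /(congr1 val)/= h0 := xI _ _ x01; rewrite -h0 in m0.
Qed.

Lemma contrast_sqdist_singular : (r < m)%N ->
  W^T *m sqdist_mx x *m W \notin unitmx.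
Proof.
move=> rm; rewrite -row_full_unit /row_full contrast_sqdist neq_ltn.
apply/orP; left; apply: leq_ltn_trans rm.
apply: leq_trans (mxrankS (scalemx_sub _ (submx_refl _))) _.
by apply: leq_trans (mxrankM_maxr _ _) _; exact: rank_leq_row.
Qed.

End Estimates.

(** * Expansion of the correlation matrix on contrasts *)

Section KrigingExpansion.
Variables (R : realType) (r m : nat) (x : 'I_m.+1 -> 'cV[R]_r).
Variable W : 'M[R]_(m.+1, m).
Hypothesis WW : W^T *m W = 1%:M.
Hypothesis W1 : (const_mx 1 : 'rV[R]_m.+1) *m W = 0.

Local Notation sqd i j := (enorm (x i - x j) ^+ 2).

Definition mixmx1 (e : R) : 'M[R]_m.+1 := \matrix_(i, j) mixint1 (sqd i j) e.

(** W^T S W multiplied by t^2, where S is the correlation matrix at the range t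
and e = 1 / t^2. *)
Definition contrast_mix (e : R) : 'M[R]_m := W^T *m mixmx x e *m W.

(** The derivative of contrast_mix with respect to ln t: as e = 1 / t^2, it is -
2 e times the derivative with respect to e. *)
Definition contrast_dmix (e : R) : 'M[R]_m := (2 * e) *: (W^T *m mixmx1 e *m W).

Lemma sqd_sym i j : sqd i j = sqd j i.
Proof.
by rewrite !enorm_sqr; apply: eq_bigr => l _; rewrite !mxE -sqrrN opprB.
Qed.

Lemma mixmx_sym e : (mixmx x e)^T = mixmx x e.
Proof. by apply/matrixP => i j; rewrite !mxE sqd_sym. Qed.

Lemma contrast_mix_sym e : (contrast_mix e)^T = contrast_mix e.
Proof. by rewrite !trmx_mul trmxK mixmx_sym mulmxA. Qed.

Lemma contrast_dmix_sym e : (contrast_dmix e)^T = contrast_dmix e.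
Proof.
rewrite linearZ/= !trmx_mul trmxK mulmxA; congr (_ *: (_ *m _ *m _)).
by apply/matrixP => i j; rewrite !mxE sqd_sym.
Qed.

Lemma contrast_mix_coercive e c :
  coercive (mixmx x e) c -> coercive (contrast_mix e) c.
Proof. by move=> h w; rewrite qform_contrast -(sqnorm_contrast WW). Qed.

(** Entry by entry this is mixint_asymp; the terms 1 / e disappear by
qform_approx. *)
Lemma contrast_mix_trend : exists2 K : R, 0 < K & forall e, 0 < e <= 1 ->
  forall w, `|qform (contrast_mix e) w + ln e * qform (trendmx x W) w|
            <= K * sqnorm w.
Proof.
have [C HC] := choice (fun ij : 'I_m.+1 * 'I_m.+1 =>
  mixint_asymp (sqr_ge0 (enorm (x ij.1 - x ij.2)))).
pose K := \sum_ij `|C ij|.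
have K0 : 0 <= K by apply: sumr_ge0.
have CK i j : C (i, j) <= K.
  apply: le_trans (ler_norm _) _; rewrite /K (bigD1 (i, j))//= lerDl.
  exact: sumr_ge0.
exists (K * m.+1%:R + 1); first by rewrite ltr_wpDl// mulr_ge0.
move=> e e01 w.
have -> : qform (contrast_mix e) w + ln e * qform (trendmx x W) w =
    qform (mixmx x e) (W *m w) - qform (ln e *: sqdist_mx x) (W *m w).
  by rewrite /contrast_mix qform_contrast qformZ qform_sqdist; ring.
apply: (@le_trans _ _ (K * m.+1%:R * sqnorm (W *m w))).
  apply: (@qform_approx _ _ _ _ e^-1); first exact: sum_contrast.
  move=> i j; rewrite !mxE (mulrC (ln e)); apply: le_trans (CK i j).
  exact: (HC (i, j)).
by rewrite (sqnorm_contrast WW) ler_wpM2r ?sqnorm_ge0// lerDl.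
Qed.

(** Entry by entry this is mixint1_asymp; the terms 1 / e disappear by
qform_approx. *)
Lemma contrast_dmix_trend : exists2 K : R, 0 < K & forall e, 0 < e ->
  forall w, `|qform (contrast_dmix e) w - 2 * qform (trendmx x W) w|
            <= K * Num.sqrt e * sqnorm w.
Proof.
pose K := \sum_(ij : 'I_m.+1 * 'I_m.+1) mix_cst (sqd ij.1 ij.2).
have C0 (ij : 'I_m.+1 * 'I_m.+1) : 0 <= mix_cst (sqd ij.1 ij.2).
  by rewrite /mix_cst addr_ge0 ?mulr_ge0 ?expR_ge0 ?exprn_ge0 ?sqrtr_ge0.
have K0 : 0 <= K by apply: sumr_ge0 => ij _; exact: C0.
have CK i j : mix_cst (sqd i j) <= K.
  rewrite /K (bigD1 (i, j))//= lerDl.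
  by apply: sumr_ge0 => ij _; exact: C0.
exists (2 * K * m.+1%:R + 1); first by rewrite ltr_wpDl// !mulr_ge0.
move=> e e0 w.
have -> : qform (contrast_dmix e) w - 2 * qform (trendmx x W) w =
  2 * (qform (e *: mixmx1 e) (W *m w) - qform (- sqdist_mx x) (W *m w)).
  rewrite /contrast_dmix qformZ qform_contrast qformZ.
  by rewrite (qformN (sqdist_mx x)) qform_sqdist; ring.
rewrite normrM ger0_norm//.
apply: (@le_trans _ _ (2 * (K * Num.sqrt e * m.+1%:R * sqnorm (W *m w)))).
  rewrite ler_pM2l//; apply: (@qform_approx _ _ _ _ e^-1).
    exact: sum_contrast.
  move=> i j; rewrite !mxE opprK.
  apply: le_trans (mixint1_asymp _ e0) _; first exact: sqr_ge0.
  by rewrite ler_wpM2r ?sqrtr_ge0.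
rewrite (sqnorm_contrast WW) mulrA ler_wpM2r ?sqnorm_ge0//.
rewrite [leLHS](_ : _ = 2 * K * m.+1%:R * Num.sqrt e); last by ring.
by rewrite ler_wpM2r ?sqrtr_ge0// lerDl.
Qed.

Lemma corr_mxE t : 0 < t -> corr_mx x 1 t = (t ^+ 2)^-1 *: mixmx x (t ^+ 2)^-1.
Proof.
by move=> t0; apply/matrixP => i j; rewrite !mxE matern1E// sqrtr_ge0.
Qed.

Lemma corrW_mxE (t : R) : 0 < t ->
  @corrW_mx R r m.+1 x W 1 t = (t ^+ 2)^-1 *: contrast_mix (t ^+ 2)^-1.
Proof. by move=> t0; rewrite /corrW_mx corr_mxE// -scalemxAr -scalemxAl. Qed.

Lemma is_derive_matern1 (q t : R) : 0 <= q -> 0 < t ->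
  is_derive t 1 (fun t : R => (t ^+ 2)^-1 * mixint q (t ^+ 2)^-1)
    ((t ^+ 3)^-1 * (2 * (t ^+ 2)^-1 * mixint1 q (t ^+ 2)^-1
                    - 2 * mixint q (t ^+ 2)^-1)).
Proof.
move=> q0 t0; have e0 : 0 < (t ^+ 2)^-1 by rewrite invr_gt0 exprn_gt0.
have d1 : is_derive t 1 (fun t : R => (t ^+ 2)^-1) (- 2 / t ^+ 3).
  have t20 : t ^+ 2 != 0 by rewrite expf_neq0 ?gt_eqF.
  have dX : is_derive t 1 (fun t : R => t ^+ 2) (2 * t).
    by apply: is_derive_eq; rewrite /GRing.scale/=; ring.
  split; first by apply: derivableV => //; case: dX.
  rewrite deriveV//.
  have [_ ->] := dX; rewrite /GRing.scale/=; field; rewrite gt_eqF//.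
have d2 := is_derive_mixint q0 e0.
have d3 := @is_derive1_comp R (mixint q) (fun t : R => (t ^+ 2)^-1) t _ _ d2 d1.
have d4 := is_deriveM d1 d3.
apply: (is_derive_eq d4); rewrite /GRing.scale/=.
by move: (mixint _ _) (mixint1 _ _) => a b; field; rewrite gt_eqF.
Qed.

Lemma contrast_entry (A : 'M[R]_m.+1) i j :
  (W^T *m A *m W) i j = \sum_k \sum_l W k i * W l j * A k l.
Proof.
rewrite -mulmxA mxE; apply: eq_bigr => k _; rewrite !mxE mulr_sumr.
by apply: eq_bigr => l _; ring.
Qed.

(** The term - 2 contrast_mix comes from differentiating the factor 1 / t^2, the
other one from the dependence of the mixture on e. *)
Lemma dcorrW_mxE (t : R) : 0 < t ->
  @dcorrW_mx R r m.+1 x W 1 t = (t ^+ 3)^-1 *: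
    (contrast_dmix (t ^+ 2)^-1 - 2 *: contrast_mix (t ^+ 2)^-1).
Proof.
move=> t0; apply/matrixP => i j; rewrite mxE derive1E.
pose h k l (s : R) := (s ^+ 2)^-1 * mixint (sqd k l) (s ^+ 2)^-1.
pose g (s : R) := \sum_k \sum_l W k i * W l j * h k l s.
rewrite (@near_eq_derive _ _ _ _ g); last first.
  near=> s; have s0 : 0 < s by near: s; exact: lt_nbhsr.
  rewrite corrW_mxE// mxE contrast_entry mulr_sumr.
  apply: eq_bigr => k _; rewrite mulr_sumr.
  by apply: eq_bigr => l _; rewrite mxE /h; ring.
have dg : is_derive t 1 g (\sum_k \sum_l W k i * W l j *
    ((t ^+ 3)^-1 * (2 * (t ^+ 2)^-1 * mixint1 (sqd k l) (t ^+ 2)^-1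
                    - 2 * mixint (sqd k l) (t ^+ 2)^-1))).
  have -> : g = \sum_k \sum_l (W k i * W l j) *: h k l.
    by apply/funext => s; rewrite fct_sumE; apply: eq_bigr => k _; rewrite fct_sumE.
  apply: is_derive_sum => k; apply: is_derive_sum => l; apply: is_deriveZ.
  by apply: is_derive_matern1; rewrite ?sqr_ge0.
have [_ ->] := dg.
set P := W^T *m mixmx1 (t ^+ 2)^-1 *m W.
set Q := W^T *m mixmx x (t ^+ 2)^-1 *m W.
have -> : ((t ^+ 3)^-1 *: (contrast_dmix (t ^+ 2)^-1
      - 2 *: contrast_mix (t ^+ 2)^-1)) i j
    = (t ^+ 3)^-1 * (2 * (t ^+ 2)^-1 * P i j - 2 * Q i j).
  by rewrite /contrast_dmix /contrast_mix -/P -/Q; move: P Q => P Q; rewrite !mxE.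
rewrite !contrast_entry !mulr_sumr -sumrB mulr_sumr; apply: eq_bigr => k _.
rewrite !mulr_sumr -sumrB mulr_sumr; apply: eq_bigr => l _.
by rewrite !mxE; ring.
Unshelve. all: by end_near. Qed.

End KrigingExpansion.

(** * The reference prior *)

(** tr (M^2) - (tr M)^2 / m is, up to the factor m, a variance of eigenvalues:
it is invariant under translation by a scalar matrix and homogeneous of degree
2. *)
Lemma trace_variance_shift (R : realType) (m : nat) (B : 'M[R]_m) (k u : R) :
  (0 < m)%N ->
  \tr ((k *: (B - u%:M)) *m (k *: (B - u%:M)))
    - m%:R^-1 * (\tr (k *: (B - u%:M))) ^+ 2
  = k ^+ 2 * (\tr (B *m B) - m%:R^-1 * (\tr B) ^+ 2).
Proof.
move=> m0; have mR : m%:R != 0 :> R by rewrite pnatr_eq0 -lt0n.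
rewrite -scalemxAl -scalemxAr !mxtraceZ.
have -> : \tr (B - u%:M) = \tr B - m%:R * u.
  by rewrite raddfB/= mxtrace_scalar mulr_natl.
have -> : \tr ((B - u%:M) *m (B - u%:M))
    = \tr (B *m B) - 2 * u * \tr B + m%:R * u ^+ 2.
  rewrite mulmxBl !mulmxBr mul_mx_scalar !mul_scalar_mx scale_scalar_mx.
  rewrite !raddfB/= !mxtraceZ mxtrace_scalar -mulr_natl; ring.
by move: (\tr (B *m B)) (\tr B) => p q; field.
Qed.

Section PriorBound.
Variables (R : realType) (r m : nat) (x : 'I_m.+1 -> 'cV[R]_r).
Variable W : 'M[R]_(m.+1, m).
Hypothesis WW : W^T *m W = 1%:M.
Hypothesis W1 : (const_mx 1 : 'rV[R]_m.+1) *m W = 0.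
Hypothesis xI : injective x.

Lemma ln_sqrV (t : R) : 0 < t -> ln ((t ^+ 2)^-1) = - (2 * ln t).
Proof. by move=> t0; rewrite lnV ?posrE ?exprn_gt0// lnXn// mulr_natl. Qed.

Lemma sqrtr_sqrV (t : R) : 0 < t -> Num.sqrt ((t ^+ 2)^-1) = t^-1.
Proof. by move=> t0; rewrite -exprVn sqrtr_sqr ger0_norm// invr_ge0 ltW. Qed.

Lemma ge1_of_ln (t : R) : 1 <= ln t -> 1 < t.
Proof.
by move=> lt1; rewrite ltNge; apply/negP => /ln_le0 h; lra.
Qed.

(** By contrast_mix_trend, 2 (ln t) T <= N + K1 I, where T is the trend matrix
and N is contrast_mix, and I <= N / c. The bound on contrast_dmix follows,
because the error 1 / t in contrast_dmix_trend is at most 1 / ln t. *)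
Lemma contrast_mix_bounds : exists c K : R, [/\ 0 < c, 0 < K &
  forall t, 1 <= ln t -> let e := (t ^+ 2)^-1 in
    [/\ coercive (mixmx x e) c,
        coercive (contrast_mix x W e) c,
        forall w, ln t * qform (trendmx x W) w <= K * qform (contrast_mix x W e) w
      & forall w, `|qform (contrast_dmix x W e) w|
                  <= K / ln t * qform (contrast_mix x W e) w]].
Proof.
have [c c0 Hc] := mixmx_coercive xI (ltn0Sn m).
have [K1 K10 H1] := contrast_mix_trend x WW W1.
have [K2 K20 H2] := contrast_dmix_trend x WW W1.
pose K := 1 + K1 / c + K2 / c.
have k1 : 0 < K1 / c by rewrite divr_gt0.
have k2 : 0 < K2 / c by rewrite divr_gt0.
exists c, K; split=> //; first by rewrite /K; lra.
move=> t lt1 e; have t1 := ge1_of_ln lt1.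
have t0 : 0 < t by lra.
have e01 : 0 < e <= 1.
  by rewrite invr_gt0 exprn_gt0//= invf_le1 ?exprn_gt0// exprn_ege1// ltW.
have e0 : 0 < e by case/andP: e01.
have cC := contrast_mix_coercive WW (Hc e e01).
have trend w : 2 * (ln t * qform (trendmx x W) w)
    <= (1 + K1 / c) * qform (contrast_mix x W e) w.
  have := H1 e e01 w; rewrite ln_sqrV// ler_norml => /andP[h _].
  have h2 := cC w.
  have h3 : K1 * sqnorm w <= K1 / c * qform (contrast_mix x W e) w.
    by rewrite -mulrA ler_pM2l// ler_pdivlMl.
  by lra.
have f0 w : 0 <= qform (contrast_mix x W e) w.
  by apply: le_trans (cC w); rewrite mulr_ge0 ?sqnorm_ge0// ltW.
split=> //; first exact: Hc.
- move=> w; have g0 := trendmx_ge0 x W1 w.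
  have lg : 0 <= ln t * qform (trendmx x W) w by rewrite mulr_ge0//; lra.
  have := trend w; have := mulr_ge0 (ltW k2) (f0 w); rewrite /K; lra.
- move=> w; have := H2 e e0 w; rewrite sqrtr_sqrV// => h.
  have h1 : `|qform (contrast_dmix x W e) w|
      <= 2 * qform (trendmx x W) w + K2 * t^-1 * sqnorm w.
    have g0 := trendmx_ge0 x W1 w.
    by move: h; rewrite !ler_norml => /andP[a b]; apply/andP; split; lra.
  apply: le_trans h1 _; rewrite [leRHS]mulrAC ler_pdivlMr; last lra.
  have h3 : K2 * t^-1 * sqnorm w * ln t <= K2 / c * qform (contrast_mix x W e) w.
    apply: (@le_trans _ _ (K2 * sqnorm w)).
      have -> : K2 * t^-1 * sqnorm w * ln t = K2 * sqnorm w * (ln t / t) by ring.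
      rewrite ler_piMr ?mulr_ge0 ?sqnorm_ge0 ?(ltW K20)// ler_pdivrMr// mul1r.
      exact/ltW/ln_sublinear.
    by rewrite -mulrA ler_pM2l// ler_pdivlMl//; exact: cC.
  have := trend w; rewrite /K; lra.
Qed.

Lemma ref_priorE (t : R) : 0 < t -> let e := (t ^+ 2)^-1 in
  contrast_mix x W e \in unitmx -> (0 < m)%N ->
  let B := contrast_dmix x W e *m invmx (contrast_mix x W e) in
  @ref_prior R r m.+1 x W 1 t
  = Num.sqrt ((t ^+ 2)^-1 * (\tr (B *m B) - m%:R^-1 * (\tr B) ^+ 2)).
Proof.
move=> t0 e uN m0 B; rewrite /ref_prior dcorrW_mxE// corrW_mxE// -/e.
have e0 : e != 0 by rewrite /e invr_neq0// expf_neq0// gt_eqF.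
have mR : m%:R != 0 :> R by rewrite pnatr_eq0 -lt0n.
have -> : m.+1%:R - 1 = m%:R :> R by rewrite -natr1 addrK.
have -> : ((t ^+ 3)^-1 *: (contrast_dmix x W e - 2 *: contrast_mix x W e)) *m
     invmx (e *: contrast_mix x W e) = t^-1 *: (B - 2%:M).
  rewrite /B; move: (contrast_dmix x W e) (contrast_mix x W e) uN => D N uN.
  rewrite invmxZ; last by rewrite unitmxZ ?unitfE.
  rewrite -scalemxAr -scalemxAl scalerA mulmxBl -(scalemxAl 2 N).
  rewrite mulmxV// scalemx1; congr (_ *: _).
  by rewrite /e invrK; field; rewrite gt_eqF.
by rewrite trace_variance_shift// exprVn.
Qed.

Lemma ref_prior_le : (0 < m)%N -> exists2 K : R, 0 < K &
  forall t, 1 <= ln t -> 0 <= @ref_prior R r m.+1 x W 1 t <= K / (t * ln t).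
Proof.
move=> m0; have [c [K [c0 K0 H]]] := contrast_mix_bounds.
exists (m%:R * K); first by rewrite mulr_gt0// ltr0n.
move=> t lt1; have t1 := ge1_of_ln lt1; have t0 : 0 < t by lra.
have [_ cC _ dB] := H t lt1; set e := (t ^+ 2)^-1 in cC dB.
have uN := coercive_unitmx c0 (contrast_mix_sym x W e) cC.
rewrite ref_priorE// -/e sqrtr_ge0/=.
set B := _ *m invmx _.
have trB : \tr (B *m B) <= (m%:R * (K / ln t)) ^+ 2.
  rewrite exprMn.
  exact: trace_sqr_le c0 (contrast_mix_sym x W e) cC (contrast_dmix_sym x W e) dB.
have b0 : 0 <= m%:R * K / (t * ln t).
  by rewrite divr_ge0 ?mulr_ge0// ltW//; lra.
rewrite -[leRHS]ger0_norm// -sqrtr_sqr ler_wsqrtr//.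
apply: (@le_trans _ _ ((t ^+ 2)^-1 * (m%:R * (K / ln t)) ^+ 2)).
  rewrite ler_wpM2l ?invr_ge0 ?sqr_ge0//; apply: le_trans trB.
  by rewrite gerBl mulr_ge0 ?sqr_ge0 ?invr_ge0.
rewrite le_eqVlt; apply/orP; left; apply/eqP.
by field; rewrite !gt_eqF//; lra.
Qed.

(** A diagonal entry of the trend matrix is positive, so the same diagonal entry
of contrast_mix is at least a multiple of ln t. *)
Lemma det_contrast_mix_ge : (0 < m)%N -> exists2 K : R, 0 < K &
  forall t, 1 <= ln t -> K * ln t <= \det (contrast_mix x W (t ^+ 2)^-1).
Proof.
move=> m0; have [i Ti] := trendmx_diag WW W1 xI m0.
have [c [K [c0 K0 H]]] := contrast_mix_bounds.
exists (trendmx x W i i / K * c ^+ m.-1).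
  by rewrite mulr_gt0 ?exprn_gt0// divr_gt0.
move=> t lt1; have [_ cC tr _] := H t lt1.
apply: le_trans (det_coercive_diag i c0 (contrast_mix_sym x W _) cC).
rewrite mulrAC ler_wpM2r ?exprn_ge0 ?(ltW c0)//.
have := tr (delta_mx i 0); rewrite !qform_delta => h.
by rewrite mulrAC ler_pdivrMr// mulrC [leRHS]mulrC.
Qed.

End PriorBound.

(** * The integrated likelihood *)

Section LikelihoodBound.
Variable R : realType.
Notation mu := (@lebesgue_measure R).

Lemma powR_exp (a p : R) : 0 < a -> a `^ p = expR (p * ln a).
Proof. by move=> a0; rewrite /powR gt_eqF. Qed.

Lemma sqrt_exp (a : R) : 0 < a -> Num.sqrt a = expR (ln a / 2).
Proof. by move=> a0; rewrite -powR12_sqrt ?(ltW a0)// powR_exp// mulrC. Qed.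

(** ln z <= z at z = X / (4 p). *)
Lemma mul_ln_le (p X : R) : 0 <= p -> 0 < X -> p * ln X <= X / 4 + p * ln (4 * p).
Proof.
rewrite le_eqVlt => /predU1P[<-|p0] X0; first by rewrite !mul0r addr0 divr_ge0// ltW.
have : ln (X / (4 * p)) <= X / (4 * p).
  by apply/ltW/ln_sublinear; rewrite divr_gt0// mulr_gt0.
rewrite ln_div ?posrE ?mulr_gt0// lerBlDr => h.
have : p * ln X <= p * (X / (4 * p) + ln (4 * p)) by rewrite ler_pM2l.
by rewrite mulrDr (_ : p * (X / (4 * p)) = X / 4)//; field; rewrite gt_eqF.
Qed.

(** Up to a constant, the inverse-gamma density with shape 1 and scale Q / 4. *)
Definition invgamma (Q s : R) : R := Q / s ^+ 2 * expR (- (Q / (4 * s))).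

Lemma continuous_invgamma Q : {in `](0 : R), +oo[, continuous (invgamma Q)}.
Proof.
move=> s s0; apply: cvgM; first exact: continuous_inversion_deriv.
move: s0; rewrite in_itv/= andbT => s0.
apply: continuous_comp; last exact: continuous_expR.
apply: cvgN; apply: cvgM; first exact: cvg_cst.
apply: cvgV; first by rewrite gt_eqF// mulr_gt0.
by apply: cvgM; [exact: cvg_cst|exact: cvg_id].
Qed.

Lemma invgamma_ge0 (Q s : R) : 0 <= Q -> 0 <= invgamma Q s.
Proof. by move=> Q0; rewrite mulr_ge0 ?expR_ge0// divr_ge0// sqr_ge0. Qed.

(** On ]0, Q] the inversion s -> Q^2 / s turns the integrand into an exponential
of integral at most 4; on [Q, +oo[ it is at most Q / s^2, of integral 1. *)
Lemma integral_invgamma_le (Q : R) : 0 < Q ->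
  (\int[mu]_(s in `](0%R : R), +oo[) (invgamma Q s)%:E <= 5%:E)%E.
Proof.
move=> Q0.
have UI : `](0 : R), +oo[%classic = `](0 : R), Q] `|` `]Q, +oo[.
  apply/seteqP; split=> s /=; rewrite !in_itv/= !andbT.
    by move=> s0; case: (leP s Q) => sa; [left; rewrite s0|right].
  by case=> [/andP[]//|]; apply: lt_trans.
have mG : measurable_fun `](0 : R), +oo[ (invgamma Q).
  by apply: continuous_measurable_0y; exact: continuous_invgamma.
have sub1 : `]Q, +oo[ `<=` `](0 : R), +oo[.
  by move=> s /=; rewrite !in_itv/= !andbT; apply: lt_trans.
have sub2 : `[Q, +oo[ `<=` `](0 : R), +oo[.
  by move=> s /=; rewrite !in_itv/= !andbT; apply: lt_le_trans.
have mD : measurable_fun `](0 : R), +oo[ (fun s : R => Q ^+ 2 / s ^+ 2).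
  by apply: continuous_measurable_0y; exact: continuous_inversion_deriv.
have c0 : 0 < (4 * Q)^-1 by rewrite invr_gt0 mulr_gt0.
have /integrableP[mE _] := integrable_exp c0.
rewrite UI ge0_integral_setU//=; last 3 first.
- by rewrite -UI; apply/measurable_EFinP.
- by move=> s _; rewrite lee_fin invgamma_ge0// ltW.
- rewrite disj_set2E; apply/eqP; rewrite -subset0 => s /= [].
  by rewrite !in_itv/= andbT => /andP[_ h1] h2; lra.
have -> : (5%:E = 4%:E + 1%:E :> \bar R)%E by rewrite -EFinD; congr EFin; ring.
apply: leeD.
  rewrite (integral_inversion Q0 (@continuous_invgamma Q)); last first.
    by move=> s _; rewrite invgamma_ge0// ltW.
  apply: (@le_trans _ _ (\int[mu]_(s in `](0%R : R), +oo[)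
      (Q^-1%:E * (expR (- ((4 * Q)^-1 * s)))%:E))%E).
    apply: (@le_trans _ _ (\int[mu]_(s in `[Q, +oo[)
      (Q^-1%:E * (expR (- ((4 * Q)^-1 * s)))%:E))%E).
      rewrite le_eqVlt; apply/orP; left; apply/eqP; apply: eq_integral => s.
      rewrite inE/= in_itv/= andbT => sQ; have s0 := lt_le_trans Q0 sQ.
      rewrite -EFinM; congr EFin; rewrite /invgamma.
      have -> : Q / (4 * (Q ^+ 2 / s)) = (4 * Q)^-1 * s by field; rewrite !gt_eqF.
      by move: (expR _) => E; field; rewrite !gt_eqF.
    apply: ge0_subset_integral => //=.
    - exact: (measurable_funeM _ mE).
    - by move=> s _; rewrite -EFinM lee_fin mulr_ge0 ?expR_ge0// invr_ge0 ltW.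
  rewrite ge0_integralZl_EFin//=; last by rewrite invr_ge0 ltW.
  rewrite integral_exp ?invr_gt0 ?mulr_gt0// -EFinM lee_fin.
  by rewrite le_eqVlt; apply/orP; left; apply/eqP; field; rewrite gt_eqF.
rewrite integral_itv_obnd_cbnd; last first.
  by apply/measurable_EFinP; exact: measurable_funS mG.
apply: (@le_trans _ _ (\int[mu]_(s in `[Q, +oo[)
    (Q^-1%:E * (Q ^+ 2 / s ^+ 2)%:E))%E).
  apply: ge0_le_integral => //=.
  - by move=> s _; rewrite lee_fin invgamma_ge0// ltW.
  - by apply/measurable_EFinP; exact: measurable_funS mG.
  - by apply: measurable_funeM; apply/measurable_EFinP; exact: measurable_funS mD.
  - move=> s; rewrite in_itv/= andbT => sQ; rewrite -EFinM lee_fin.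
    have s0 := lt_le_trans Q0 sQ.
    rewrite (_ : Q^-1 * (Q ^+ 2 / s ^+ 2) = Q / s ^+ 2); last by field; rewrite !gt_eqF.
    rewrite /invgamma ler_piMr//.
      by rewrite divr_ge0 ?sqr_ge0// ltW.
    by rewrite -[leRHS]expR0 ler_expR oppr_le0 divr_ge0 ?mulr_ge0// ltW.
rewrite ge0_integralZl_EFin//=; last 3 first.
- by move=> s _; rewrite lee_fin divr_ge0 ?sqr_ge0.
- by apply/measurable_EFinP; exact: measurable_funS mD.
- by rewrite invr_ge0 ltW.
have c1 : {in `](0 : R), +oo[, continuous (cst (1 : R) : R -> R)}.
  by move=> s _; exact: cvg_cst.
have -> : (\int[mu]_(s in `[Q, +oo[) (Q ^+ 2 / s ^+ 2)%:E
          = \int[mu]_(s in `](0%R : R), Q]) 1%:E)%E.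
  rewrite (integral_inversion Q0 c1)//.
  by apply: eq_integral => s _; rewrite /= mul1r.
rewrite integral_cst//= lebesgue_measure_itv/= lte_fin Q0 oppr0 adde0 mul1e -EFinM.
by rewrite mulVf// gt_eqF.
Qed.

Lemma integral_gaussian (k b0 : R) : 0 < k ->
  (\int[mu]_(b in [set: R]) (expR (- (k * (b - b0) ^+ 2)))%:E
   = (Num.sqrt (pi / k))%:E)%E.
Proof.
move=> k0; pose sg := Num.sqrt ((2 * k)^-1).
have k20 : 0 < (2 * k)^-1 by rewrite invr_gt0 mulr_gt0.
have sg0 : sg != 0 by rewrite gt_eqF// sqrtr_gt0.
have sg2 : sg ^+ 2 = (2 * k)^-1 by rewrite sqr_sqrtr// ltW.
have peak0 := normal_peak_gt0 sg0.
have peakE : (normal_peak sg)^-1 = Num.sqrt (pi / k).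
  rewrite /normal_peak invrK sg2 -mulr_natr; congr Num.sqrt.
  by field; rewrite gt_eqF.
transitivity (\int[mu]_(b in [set: R])
    ((normal_peak sg)^-1%:E * (normal_pdf b0 sg b)%:E))%E.
  apply: eq_integral => b _; rewrite normal_pdfE//= -EFinM mulKf ?gt_eqF//.
  rewrite /normal_fun sg2; congr (expR _)%:E.
  by rewrite -mulr_natr; field; rewrite gt_eqF.
rewrite ge0_integralZl_EFin//=.
- by rewrite integral_normal_pdf mule1 peakE.
- by move=> b _; rewrite lee_fin normal_pdf_ge0.
- by apply/measurable_EFinP; exact: measurable_normal_pdf.
- by rewrite invr_ge0 ltW.
Qed.

(** Completion of the square in b. *)
Lemma qform_ones_min n (P : 'M[R]_n) (y : 'cV[R]_n) : P^T = P ->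
  0 < qform P (const_mx 1) -> exists b0 : R, forall b : R,
    qform P (y - const_mx b) =
    qform P (const_mx 1) * (b - b0) ^+ 2 + qform P (y - const_mx b0).
Proof.
move=> Ps a0; set a := qform P (const_mx 1) in a0 *; pose o : 'cV[R]_n := const_mx 1.
pose g := (y^T *m P *m o) 0 0.
have g' : (o^T *m P *m y) 0 0 = g.
  rewrite /g -[in RHS](trmxK (y^T *m P *m o)) [RHS]mxE.
  by rewrite (trmx_mul (y^T *m P)) (trmx_mul y^T) trmxK Ps mulmxA.
have E b : qform P (y - const_mx b) = qform P y - 2 * b * g + b ^+ 2 * a.
  have -> : y - const_mx b = 1 *: y + (- b) *: o.
    by rewrite scale1r; apply/colP => i; rewrite !mxE mulr1.
  by rewrite qform_comb g' -/g -/a; ring.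
by exists (g / a) => b; rewrite !E; field; rewrite gt_eqF.
Qed.

(** The logarithm of (2 pi)^{-m/2} times the constant (4 p)^p of mul_ln_le, for
p = m/2 - 1. *)
Definition lik_cst (m : nat) : R := (m%:R / 2 - 1) * ln (4 * (m%:R / 2 - 1))
  - m%:R / 2 * ln (2 * pi).

(** The integral over b is Gaussian. What remains, for m = n - 1, is a constant
times s^{-m/2 - 1} exp (- Q / (2 s)), and the bound (Q/s)^p <= const exp (Q / (4
s)) with p = m/2 - 1 reduces it to Q^{-m/2} times invgamma Q s. All factors are
positive and are written as exponentials, so that the comparison is linear in
the logarithms. *)
Lemma likelihood_le r m (x : 'I_m.+1 -> 'cV[R]_r) (t c D q : R)
    (y : 'cV[R]_m.+1) : (1 < m)%N -> 0 < c -> 0 < D -> 0 < q ->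
  let S := corr_mx x 1 t in
  S^T = S -> coercive S c ->
  D <= \det S * qform (invmx S) (const_mx 1) ->
  (forall b, q <= qform (invmx S) (y - const_mx b)) ->
  (likelihood x 1 y t <=
   (5 * expR (lik_cst m - ln D / 2 - m%:R / 2 * ln q))%:E)%E.
Proof.
move=> m1 c0 D0 q0 S Ss Sc hD hq; pose p : R := m%:R / 2 - 1.
have uS := coercive_unitmx c0 Ss Sc.
have d0 : 0 < \det S.
  by apply: lt_le_trans (det_coercive c0 Ss Sc); rewrite exprn_gt0.
set d := \det S in d0 hD; set P := invmx S in hD hq.
have a0 : 0 < qform P (const_mx 1).
  by rewrite -(pmulr_rgt0 _ d0); apply: lt_le_trans hD.
have Ps : P^T = P by rewrite /P trmx_inv Ss.
have [b0 Hb] := qform_ones_min y Ps a0.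
set a := qform P _ in a0 Hb hD.
set Q := qform P (y - const_mx b0) in Hb.
have qQ : q <= Q by exact: hq.
have Q0 : 0 < Q by apply: lt_le_trans qQ.
have pi0 : 0 < pi :> R by exact: pi_gt0.
have p0 : 0 <= p by rewrite /p subr_ge0 ler_pdivlMr// mul1r ler_nat.
pose K := expR (lik_cst m - ln D / 2 - m%:R / 2 * ln q).
(* Completing the square leaves a Gaussian integral in b, evaluated exactly. *)
have inner s : 0 < s ->
    (\int[mu]_(b in [set: R]) (lik_integrand x 1 y t s b)%:E
    = (expR (- (m.+1%:R / 2) * ln (2 * pi * s) - ln d / 2 - Q / (2 * s) - ln s
        + ln (2 * pi * s / a) / 2))%:E)%E.
  move=> s0; pose k := a / (2 * s).
  have k0 : 0 < k by rewrite divr_gt0// mulr_gt0.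
  pose A := (2 * pi * s) `^ (- (m.+1%:R / 2)) * d `^ (- (1 / 2)) *
      expR (- (Q / (2 * s))) * s^-1.
  have A0 : 0 <= A.
    by rewrite !mulr_ge0 ?powR_ge0 ?expR_ge0// invr_ge0 ltW.
  transitivity (\int[mu]_(b in [set: R])
      (A%:E * (expR (- (k * (b - b0) ^+ 2)))%:E))%E.
    apply: eq_integral => b _; rewrite -EFinM; congr EFin.
    rewrite /lik_integrand -/S -/d -/P -/(qform P (y - const_mx b)) Hb /A.
    have -> : - (2 * s)^-1 * (a * (b - b0) ^+ 2 + Q) =
       - (Q / (2 * s)) + - (k * (b - b0) ^+ 2).
      by rewrite /k; field; rewrite gt_eqF.
    by rewrite expRD; ring.
  rewrite ge0_integralZl_EFin//=; last first.
    apply/measurable_EFinP; apply: continuous_measurable_fun => b.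
    apply: continuous_comp; last exact: continuous_expR.
    apply: cvgN; apply: cvgM; first exact: cvg_cst.
    apply: (@cvg_comp _ _ _ (fun b => b - b0) (fun z => z ^+ 2)).
      by apply: cvgB; [exact: cvg_id|exact: cvg_cst].
    exact: exprn_continuous.
  rewrite integral_gaussian// -EFinM; congr EFin.
  have -> : pi / k = 2 * pi * s / a by rewrite /k; field; rewrite !gt_eqF.
  rewrite sqrt_exp ?divr_gt0 ?mulr_gt0// /A !powR_exp ?mulr_gt0//.
  have -> : s^-1 = expR (- ln s) by rewrite expRN lnK.
  by rewrite -!expRD; congr expR; field; rewrite gt_eqF.
rewrite /likelihood.
apply: (@le_trans _ _ (\int[mu]_(s in `](0%R : R), +oo[)
    (K%:E * (invgamma Q s)%:E))%E); last first.
  rewrite ge0_integralZl_EFin//=; last 3 first.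
  - by move=> s _; rewrite lee_fin invgamma_ge0// ltW.
  - apply/measurable_EFinP; apply: continuous_measurable_0y.
    exact: continuous_invgamma.
  - exact: expR_ge0.
  rewrite mulrC EFinM; apply: lee_wpmul2l; first by rewrite lee_fin expR_ge0.
  exact: integral_invgamma_le.
pose E (s : R) := - (m%:R / 2) * (ln (2 * pi) + ln s) - ln (d * a) / 2
   - Q / (2 * s) - ln s.
have -> : (\int[mu]_(s in `]0%R, +oo[)
      \int[mu]_(b in [set: R]) (lik_integrand x 1 y t s b)%:E
    = \int[mu]_(s in `](0%R : R), +oo[) (expR (E s))%:E)%E.
  apply: eq_integral => s; rewrite inE/= in_itv/= andbT => s0.
  rewrite inner//; congr (expR _)%:E.
  rewrite ln_div ?posrE ?mulr_gt0// (lnM (x := 2 * pi)) ?posrE ?mulr_gt0//.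
  have lda : ln (d * a) = ln d + ln a by rewrite lnM.
  by rewrite /E lda -natr1; field; rewrite gt_eqF.
apply: ge0_le_integral => //=.
- apply/measurable_EFinP; apply: continuous_measurable_0y => s.
  rewrite in_itv/= andbT => s0.
  have cln : ln u @[u --> s] --> ln s by exact: continuous_ln.
  apply: continuous_comp; last exact: continuous_expR.
  apply: cvgB; last exact: cln.
  apply: cvgB; last first.
    apply: cvgM; first exact: cvg_cst.
    apply: cvgV; first by rewrite gt_eqF// mulr_gt0.
    by apply: cvgM; [exact: cvg_cst|exact: cvg_id].
  apply: cvgB; last exact: cvg_cst.
  apply: cvgM; first exact: cvg_cst.
  by apply: cvgD; [exact: cvg_cst|exact: cln].
- apply: measurable_funeM; apply/measurable_EFinP.
  by apply: continuous_measurable_0y; exact: continuous_invgamma.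
move=> s; rewrite in_itv/= andbT => s0; rewrite -EFinM lee_fin.
have -> : invgamma Q s = expR (ln Q - 2 * ln s - Q / (4 * s)).
  rewrite /invgamma !expRD lnK//; congr (_ * _ * _).
  by rewrite expRN mulr_natl -lnXn// lnK// posrE exprn_gt0.
rewrite /K -expRD ler_expR /E /lik_cst -/p.
have X0 : 0 < Q / s by rewrite divr_gt0.
have := mul_ln_le p0 X0; rewrite ln_div// => h1.
have h2 : ln D <= ln (d * a) by rewrite ler_ln// posrE mulr_gt0.
have h3 : m%:R / 2 * ln q <= m%:R / 2 * ln Q.
  by rewrite ler_wpM2l ?divr_ge0// ler_ln.
have h4 : Q / (2 * s) = 2 * (Q / s / 4) by field; rewrite gt_eqF.
have h5 : Q / (4 * s) = Q / s / 4 by field; rewrite gt_eqF.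
have h6 : p * (ln Q - ln s) = m%:R / 2 * ln Q - m%:R / 2 * ln s - ln Q + ln s.
  by rewrite /p; ring.
by rewrite h4 h5; rewrite h6 in h1; lra.
Qed.

End LikelihoodBound.

(** * The posterior *)

Section PosteriorBound.
Variables (R : realType) (r m : nat) (x : 'I_m.+1 -> 'cV[R]_r).
Variable W : 'M[R]_(m.+1, m).
Hypothesis WW : W^T *m W = 1%:M.
Hypothesis W1 : (const_mx 1 : 'rV[R]_m.+1) *m W = 0.
Hypothesis xI : injective x.

(** With M = W^T D W, the columns of cokermx M^T are killed by M^T, and a row
vector orthogonal to all of them lies in the row space of M^T. *)
Lemma trend_kernel (y : 'cV[R]_m.+1) :
  ~~ ((W^T *m y)^T <= (W^T *m sqdist_mx x *m W)^T)%MS ->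
  exists2 w : 'cV[R]_m, qform (trendmx x W) w = 0
    & ((W *m w)^T *m y) 0 0 != 0.
Proof.
set M := W^T *m _ *m W; rewrite submxE => h.
have [j hj] : exists j, ((W^T *m y)^T *m cokermx M^T) 0 j != 0.
  apply/existsP; apply: contraNT h; rewrite negb_exists => /forallP h.
  by apply/eqP/rowP => j; rewrite [RHS]mxE; apply/eqP; have := h j; rewrite negbK.
set u := col j (cokermx M^T).
have Mu : M^T *m u = 0 by rewrite /u colE mulmxA mulmx_coker mul0mx.
have uM : u^T *m M = 0 by apply: trmx_inj; rewrite trmx_mul trmxK trmx0.
exists u; first by rewrite /trendmx -/M qformN /qform uM mul0mx mxE oppr0.
have -> : ((W *m u)^T *m y) 0 0 = ((W^T *m y)^T *m u) 0 0.
  rewrite -[(W *m u)^T *m y]trmxK [LHS]mxE.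
  by rewrite (trmx_mul (W *m u)^T) trmxK mulmxA trmx_mul trmxK.
by rewrite /u colE mulmxA -colE mxE.
Qed.

(** With e = 1 / t^2, the two lower bounds fed to likelihood_le are a multiple
of e^m ln t for the determinant factor and q0 / e for Q, where the latter uses a
vector w from trend_kernel; the powers of e cancel. *)
Lemma likelihood_bound (y : 'cV[R]_m.+1) : (1 < m)%N ->
  ~~ ((W^T *m y)^T <= (W^T *m sqdist_mx x *m W)^T)%MS ->
  exists2 K : R, 0 < K & forall t, 1 <= ln t ->
    (likelihood x 1 y t <= (K * expR (- (ln (ln t) / 2)))%:E)%E.
Proof.
move=> m1 /trend_kernel[w Tw hw].
have m0 : (0 < m)%N by apply: leq_trans m1.
set b := ((W *m w)^T *m y) 0 0 in hw.
have [c [K0 [c0 _ Hc]]] := contrast_mix_bounds WW W1 xI.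
have [K1 K10 H1] := contrast_mix_trend x WW W1.
have [K2 K20 H2] := det_contrast_mix_ge WW W1 xI m0.
have w0 : w != 0.
  apply: contra hw => /eqP wE.
  by rewrite /b wE mulmx0 trmx0 mul0mx mxE.
have sw0 := sqnorm_gt0 w0.
have b20 : 0 < b ^+ 2 by rewrite lt_neqAle sqr_ge0 andbT eq_sym expf_neq0.
pose q0 := b ^+ 2 / (K1 * sqnorm w).
have q00 : 0 < q0 by rewrite divr_gt0// mulr_gt0.
have nK : 0 < m.+1%:R * K2 by rewrite mulr_gt0// ltr0n.
exists (5 * expR (lik_cst R m - ln (m.+1%:R * K2) / 2 - m%:R / 2 * ln q0)).
  by rewrite mulr_gt0// expR_gt0.
move=> t lt1; have t1 := ge1_of_ln lt1; have t0 : 0 < t by lra.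
have ln0 : 0 < ln t by lra.
have [mC _ _ _] := Hc t lt1.
set e := (t ^+ 2)^-1 in mC *.
have e0 : 0 < e by rewrite invr_gt0 exprn_gt0.
have e1 : e <= 1 by rewrite invf_le1 ?exprn_gt0// exprn_ege1// ltW.
have SE : corr_mx x 1 t = e *: mixmx x e by exact: corr_mxE.
have Ss : (corr_mx x 1 t)^T = corr_mx x 1 t by rewrite SE linearZ/= mixmx_sym.
have Sc : coercive (corr_mx x 1 t) (e * c).
  by move=> u; rewrite SE qformZ -mulrA ler_pM2l.
have ec0 : 0 < e * c by rewrite mulr_gt0.
pose D := m.+1%:R * K2 * e ^+ m * ln t.
have D0 : 0 < D by rewrite !mulr_gt0// ?exprn_gt0.
have q1 : 0 < q0 / e by rewrite divr_gt0.
have hD : D <= \det (corr_mx x 1 t) * qform (invmx (corr_mx x 1 t)) (const_mx 1).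
  rewrite (det_contrast WW W1); last exact: coercive_unitmx ec0 Ss Sc.
  rewrite SE -scalemxAr -scalemxAl detZ /D -!mulrA ler_pM2l ?ltr0n//.
  rewrite mulrCA ler_pM2l ?exprn_gt0//; exact: H2.
(* Cauchy-Schwarz against the contrast W w, at which the form of the correlation
   matrix is at most e K1 |w|^2. *)
have hq b0 : q0 / e <= qform (invmx (corr_mx x 1 t)) (y - const_mx b0).
  have := qform_cauchy (W *m w) (y - const_mx b0) ec0 Ss Sc.
  have -> : ((W *m w)^T *m (y - const_mx b0)) 0 0 = b.
    rewrite mulmxBr.
    have -> : (W *m w)^T *m (const_mx b0 : 'cV[R]_m.+1) = 0.
      have -> : const_mx b0 = b0 *: const_mx 1 :> 'cV[R]_m.+1.
        by apply/colP => i; rewrite !mxE mulr1.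
      by rewrite trmx_mul -scalemxAr -mulmxA (contrast_ones W1) mulmx0 scaler0.
    by rewrite subr0.
  have Ub : qform (corr_mx x 1 t) (W *m w) <= e * (K1 * sqnorm w).
    rewrite SE qformZ ler_pM2l// -qform_contrast.
    have := H1 e; rewrite e0 e1 => /(_ isT w).
    by rewrite Tw mulr0 addr0 ler_norml => /andP[].
  set Z := qform (invmx _) _ => h.
  rewrite /q0 -mulrA -invfM ler_pdivrMr ?mulr_gt0//.
  have Z0 : 0 <= Z.
    have u0 : 0 < qform (corr_mx x 1 t) (W *m w).
      by apply: lt_le_trans (Sc _); rewrite (sqnorm_contrast WW) mulr_gt0.
    by rewrite -(pmulr_rge0 _ u0); apply: le_trans h; rewrite sqr_ge0.
  apply: le_trans h _; rewrite mulrC (mulrC _ e); exact: ler_wpM2l.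
apply: le_trans (likelihood_le m1 ec0 D0 q1 Ss Sc hD hq) _.
rewrite lee_fin -[leRHS]mulrA -expRD ler_pM2l// ler_expR.
have -> : ln D = ln (m.+1%:R * K2) + m%:R * ln e + ln (ln t).
  rewrite /D; move: (m.+1%:R * K2) nK => G G0.
  by rewrite !lnM ?posrE ?mulr_gt0 ?exprn_gt0// lnXn// mulr_natl.
by rewrite ln_div ?posrE//; lra.
Qed.

End PosteriorBound.

Lemma likelihood_ge0 (R : realType) r n (x : 'I_n -> 'cV[R]_r) y t :
  (0 <= likelihood x 1 y t)%E.
Proof.
apply: integral_ge0 => s; rewrite /= in_itv/= andbT => s0.
apply: integral_ge0 => b _; rewrite lee_fin /lik_integrand.
by rewrite !mulr_ge0 ?powR_ge0 ?expR_ge0// invr_ge0 ltW.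
Qed.

Theorem propositionB3 (R : realType) (r n : nat) (x : 'I_n -> 'cV[R]_r)
    (W : 'M[R]_(n, n.-1)) (prior : R -> R)
    (hr : (1 <= r)%N)
    (hx : injective x)
    (hWW : W^T *m W = 1%:M)
    (h1W : (const_mx 1 : 'rV[R]_n) *m W = 0)
    (hn : (r + 3 < n)%N)
    (hprior : proportional (fun theta => (prior theta)%:E)
                           (fun theta => (ref_prior x W 1 theta)%:E)) :
  [/\ prior =O_ +oo (fun theta : R => theta^-1 * (ln theta)^-1),
      W^T *m sqdist_mx x *m W \notin unitmx
    & forall (y : 'cV[R]_n),
        ~~ ((W^T *m y)^T <= (W^T *m sqdist_mx x *m W)^T)%MS ->
        forall post : R -> \bar R,
          proportional post
            (fun theta => (likelihood x 1 y theta * (prior theta)%:E)%E) ->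
          ebigO_pinfty post
            (fun theta : R => theta^-1 * ln theta `^ (- (3 / 2)))].
Proof.
case: n => [//|m] in x W hx hWW h1W hn hprior *.
have rm : (r < m)%N.
  by move: hn; rewrite addn3 ltnS; apply: leq_trans; rewrite leqW// leqW.
have m1 : (1 < m)%N by apply: leq_ltn_trans rm.
have [c c0 pE] := hprior.
have [K K0 HK] := ref_prior_le hWW h1W hx (ltnW m1).
have lnbig : \forall t \near +oo, (1 : R) <= ln t.
  have : \forall t \near +oo, expR (1 : R) <= t by exact: nbhs_pinfty_ge.
  apply: filterS => t ht; rewrite -[leLHS]expRK ler_ln// posrE ?expR_gt0//.
  exact: lt_le_trans (expR_gt0 1) ht.
have prior_bound t : 1 <= ln t -> 0 <= prior t <= c * K / (t * ln t).
  move=> lt1; have t0 : 0 < t by apply: lt_trans (ge1_of_ln lt1).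
  have -> : prior t = c * ref_prior x W 1 t by apply: EFin_inj; rewrite pE.
   have /andP[h1 h2] := HK t lt1.
  by rewrite mulr_ge0 ?(ltW c0)//= -mulrA ler_pM2l.
split.
- apply/eqO_exP; exists (c * K); first by rewrite mulr_gt0.
  apply: filterS lnbig => t lt1.
  have /andP[h1 h2] := prior_bound t lt1.
  have t0 : 0 < t by apply: lt_trans (ge1_of_ln lt1).
  have l0 : 0 < ln t by lra.
  rewrite !ger0_norm//; last by rewrite mulr_ge0// invr_ge0 ltW.
  by rewrite -invfM.
- exact: contrast_sqdist_singular.
- move=> y hy post [c2 c20 postE].
  have [K2 K20 HK2] := likelihood_bound hWW h1W hx m1 hy.
  exists (c2 * (K2 * (c * K))).
  apply: filterS lnbig => t lt1.
  have /andP[h1 h2] := prior_bound t lt1.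
  have t0 : 0 < t by apply: lt_trans (ge1_of_ln lt1).
  have l0 : 0 < ln t by lra.
  have L0 := likelihood_ge0 x y t.
  rewrite postE// gee0_abs; last by rewrite mule_ge0 ?mule_ge0 ?lee_fin// ltW.
  have -> : `|t^-1 * ln t `^ (- (3 / 2))| =
      expR (- (ln (ln t) / 2)) * (t * ln t)^-1.
    rewrite ger0_norm; last by rewrite mulr_ge0 ?powR_ge0// invr_ge0 ltW.
    rewrite powR_exp// invfM mulrCA; congr (_ * _).
    have -> : (ln t)^-1 = expR (- ln (ln t)) by rewrite expRN lnK.
    by rewrite -expRD; congr expR; field.
  apply: (@le_trans _ _ (c2%:E * ((K2 * expR (- (ln (ln t) / 2)))%:E
      * (c * K / (t * ln t))%:E))%E).
    apply: lee_wpmul2l; first by rewrite lee_fin ltW.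
    by apply: lee_pmul => //; exact: HK2.
  by rewrite -!EFinM lee_fin le_eqVlt; apply/orP; left; apply/eqP; ring.
Qed.
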